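(* Let $\alpha_0,\alpha_1,\beta_2\in\mathbb{C}$ with $\alpha_1\neq0$, let $f(x,y)=\left(\alpha_0+\alpha_1x,\frac{x+\beta_2y}{y}\right)$ and set $h(x)=\alpha_0+\alpha_1x$. Then the following hold. 1. If $f^p(\alpha_0,\beta_2)\neq(0,0)$ for all $p\in\mathbb{N}$, then $f$ preserves the fibration $V_1(x,y)=x$, with $V_1(f(x,y))=\alpha_0+\alpha_1V_1(x,y)$, and this invariant fibration is unique. If $\alpha_1^n=1$ for some $n>1$ and $\alpha_1\neq1$, then $f$ is integrable and $W(x,y)=x\cdot h(x)\cdot h(h(x))\cdots h^{n-1}(x)$ is a first integral of $f$. Also, when $\alpha_1=1$ and $\alpha_0=0$, $f$ is integrable. 2. If $f^p(\alpha_0,\beta_2)=(0,0)$ for some $p\ge1$, then $f$ is a $(2p+2)$-periodic map, and $W(x,y)=x\cdot h(x)\cdot h(h(x))\cdots h^{2p+1}(x)$ is a first integral of $f$. 3. If $(\alpha_0,\beta_2)=(0,0)$, then $f(x,y)=\left(\alpha_1x,\frac xy\right)$ and it preserves the two generically transverse fibrations $$V_1(x,y)=\sqrt{\alpha_1}\,y+\frac xy,\qquad V_2(x,y)=-\sqrt{\alpha_1}\,y+\frac xy,$$ with $V_1(f(x,y))=\sqrt{\alpha_1}\,V_1(x,y)$ and $V_2(f(x,y))=-\sqrt{\alpha_1}\,V_2(x,y)$. When $\alpha_1^n=1$ for some $n$, then $f$ is $2n$-periodic and $W_1=V_1^{2n}$, $W_2=V_2^{2n}$ are two independent first integrals.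
   Context: Here $\mathbb{N}$ includes $0$, and $h^j$ denotes the $j$-th iterate of $h$. The condition $f^p(\alpha_0,\beta_2)=(0,0)$ is understood as follows. Let $F:\mathbb{P}^2\dashrightarrow\mathbb{P}^2$, $F[x_0:x_1:x_2]=[x_0x_2:(\alpha_0x_0+\alpha_1x_1)x_2:x_0(x_1+\beta_2x_2)]$, be the extension of $f$, let $\tilde F$ be the map induced by $F$ on the surface obtained by blowing up $\mathbb{P}^2$ at $[0:1:0]$ and $[0:0:1]$; its only indeterminacy point is $O_0=[1:0:0]$. The condition means $\tilde F^p(A_2)=O_0$ with $A_2=[1:\alpha_0:\beta_2]$ (and $\tilde F^j(A_2)\neq O_0$ for $j<p$). Concretely, one iterates $f$ on $\mathbb{C}\times(\mathbb{C}\cup\{\infty\})$ by $(x,y)\mapsto(h(x),\beta_2+x/y)$, with $x/0=\infty$ for $x\ne0$ and $x/\infty=0$, stopping if $(0,0)$ is reached. A fibration is a nonconstant rational function $V$ on $\mathbb{C}^2$; $f$ preserves it if $f$ sends level curves of $V$ to level curves of $V$. Uniqueness means that any other preserved rational fibration has the same level curves (the same pencil of curves). $f$ is integrable if there is a nonconstant rational $V$ with $V\circ f=V$; such a $V$ is called a first integral. Two fibrations are generically transverse if their level curves are transverse at a generic point. First integrals $W_1,W_2$ are independent if they are functionally independent. $f$ is $m$-periodic if $f^m=\mathrm{id}$ as a rational map. $\sqrt{\alpha_1}$ is a fixed square root of $\alpha_1$. *)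

(* Defs.v *)
From HB Require Import structures.
From mathcomp Require Import all_boot all_order all_algebra.
From mathcomp Require Import polyXY fraction generic_quotient.
From mathcomp Require Import reals.
From mathcomp Require Import complex.

Set Implicit Arguments.
Unset Strict Implicit.
Unset Printing Implicit Defensive.

Import GRing.Theory.

Local Open Scope ring_scope.

(** Rational functions and rational maps of the plane.

    A polynomial in (x, y) is an element of [{poly {poly C}}], with the
    conventions of [polyXY]: the first coordinate x is the outer variable 'X,
    the second coordinate y is the inner one 'Y = 'X%:P, and [P.[a, b]] is the
    value of P at x = a, y = b. *)

Definition ratfun (C : fieldType) := {fraction {poly {poly C}}}.

Definition polyF (C : fieldType) (P : {poly {poly C}}) : ratfun C :=
  FracField.tofrac P.

Definition cst (C : fieldType) (c : C) : ratfun C := polyF c%:P%:P.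

Definition xF (C : fieldType) : ratfun C := polyF 'X.

Definition yF (C : fieldType) : ratfun C := polyF 'Y.

Definition nonconstant (C : fieldType) (V : ratfun C) : Prop :=
  forall c : C, V <> cst c.

Definition ratmap (C : fieldType) : Type := (ratfun C * ratfun C)%type.

Definition subst_poly (C : fieldType) (P : {poly {poly C}}) (G : ratmap C)
    : ratfun C :=
  (map_poly (map_poly (@cst C)) P).[G.1, G.2].

(** [V \o G], by substitution in a numerator and a denominator of V. It is
    meaningful (and independent of the chosen representative) when G is
    dominant, since a nonzero denominator then stays nonzero; it is only applied
    to iterates of birational maps. *)
Definition subst (C : fieldType) (V : ratfun C) (G : ratmap C) : ratfun C :=
  subst_poly \n_(repr V) G / subst_poly \d_(repr V) G.

Definition ratmap_id (C : fieldType) : ratmap C := (xF C, yF C).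

Definition ratmap_comp (C : fieldType) (F G : ratmap C) : ratmap C :=
  (subst F.1 G, subst F.2 G).

(** [m] is a period of F, not necessarily the minimal one. *)
Definition periodic (C : fieldType) (m : nat) (F : ratmap C) : Prop :=
  iter m (ratmap_comp F) (ratmap_id C) = ratmap_id C.

Definition first_integral (C : fieldType) (F : ratmap C) (V : ratfun C) : Prop :=
  nonconstant V /\ subst V F = V.

Definition integrable (C : fieldType) (F : ratmap C) : Prop :=
  exists V : ratfun C, first_integral F V.

(** Values of a rational function lie in the projective line [option C], with
    [None] the point at infinity. [takes V p v] says that p is not an
    indeterminacy point of V and that V has value v at p. *)
Definition takes (C : fieldType) (V : ratfun C) (p : C * C) (v : option C)
    : Prop :=
  exists N D : {poly {poly C}},
    [/\ D != 0, V = polyF N / polyF D &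
        match v with
        | Some c => D.[p.1, p.2] != 0 /\ N.[p.1, p.2] / D.[p.1, p.2] = c
        | None => D.[p.1, p.2] = 0 /\ N.[p.1, p.2] != 0
        end].

Definition maps_to (C : fieldType) (F : ratmap C) (p q : C * C) : Prop :=
  takes F.1 p (Some q.1) /\ takes F.2 p (Some q.2).

(** V is a fibration and F sends each level curve [V = v] (v in the projective
    line) into a level curve [V = w]; points where F or one of the two values of
    V is not defined are disregarded. *)
Definition preserves_fibration (C : fieldType) (F : ratmap C) (V : ratfun C)
    : Prop :=
  nonconstant V /\
  forall v : option C, exists w : option C,
    forall p q : C * C, takes V p v -> maps_to F p q ->
      forall w' : option C, takes V q w' -> w' = w.

Definition irreducible_curve (C : fieldType) (P : {poly {poly C}}) : Prop :=
  [/\ P != 0, P \isn't a GRing.unit &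
      forall A B : {poly {poly C}}, P = A * B ->
        A \is a GRing.unit \/ B \is a GRing.unit].

(** The irreducible curve [P = 0] is contained in (the closure of) a level curve
    of V, that is, it is a component of a level curve. *)
Definition level_component (C : fieldType) (V : ratfun C) (P : {poly {poly C}})
    : Prop :=
  irreducible_curve P /\
  exists v : option C, forall p : C * C, P.[p.1, p.2] = 0 ->
    forall v' : option C, takes V p v' -> v' = v.

(** V and W define the same pencil of curves: their level curves have the same
    irreducible components. One cannot ask for equality of the (possibly
    reducible) level sets: [x] and [x ^+ 2] define the same pencil, but a level
    set of the latter is a union of two lines [x = c] and [x = - c]. *)
Definition same_level_curves (C : fieldType) (V W : ratfun C) : Prop :=
  forall P : {poly {poly C}}, level_component V P <-> level_component W P.

Definition dpolyX (C : fieldType) (P : {poly {poly C}}) : {poly {poly C}} :=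
  P^`().

Definition dpolyY (C : fieldType) (P : {poly {poly C}}) : {poly {poly C}} :=
  map_poly (@deriv C) P.

Definition quotient_rule (C : fieldType)
    (d : {poly {poly C}} -> {poly {poly C}}) (V : ratfun C) : ratfun C :=
  let N := \n_(repr V) in let D := \d_(repr V) in
  polyF (d N * D - N * d D) / polyF D ^+ 2.

Definition dX (C : fieldType) (V : ratfun C) : ratfun C :=
  quotient_rule (@dpolyX C) V.

Definition dY (C : fieldType) (V : ratfun C) : ratfun C :=
  quotient_rule (@dpolyY C) V.

(** The level curves of V and W through p are smooth at p and their tangent
    lines, the kernels of the differentials [(a, b)] of V and [(c, d)] of W,
    meet only at 0. (If a differential vanished, its kernel would be the whole
    plane and the condition would fail.) *)
Definition transverse_at (C : fieldType) (V W : ratfun C) (p : C * C) : Prop :=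
  exists a b c d : C,
    [/\ exists v w : C, takes V p (Some v) /\ takes W p (Some w),
        takes (dX V) p (Some a) /\ takes (dY V) p (Some b),
        takes (dX W) p (Some c) /\ takes (dY W) p (Some d) &
        forall u1 u2 : C, a * u1 + b * u2 = 0 -> c * u1 + d * u2 = 0 ->
          u1 = 0 /\ u2 = 0].

Definition generically_transverse (C : fieldType) (V W : ratfun C) : Prop :=
  exists2 G : {poly {poly C}}, G != 0 &
    forall p : C * C, G.[p.1, p.2] != 0 -> transverse_at V W p.

(** Functional independence: the Jacobian determinant of (V, W) is not
    identically zero. *)
Definition independent (C : fieldType) (V W : ratfun C) : Prop :=
  dX V * dY W - dY V * dX W != 0.

Definition hmap (A : pzRingType) (a0 a1 x : A) : A := a0 + a1 * x.

Definition fmap (C : fieldType) (a0 a1 b2 : C) : ratmap C :=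
  (cst a0 + cst a1 * xF C, (xF C + cst b2 * yF C) / yF C).

Definition hprod (C : fieldType) (a0 a1 : C) (n : nat) : ratfun C :=
  \prod_(j < n) iter j (hmap (cst a0) (cst a1)) (xF C).

(** One step of f on C x (C u {oo}), in the form (x, y) |-> (h x, b2 + x / y)
    with x / 0 = oo for x <> 0 and x / oo = 0; the second coordinate [None] is
    oo. The outer [None] means that the iteration stops, at (0, 0). This is the
    action of the extension of f to the blow-up of the projective plane at
    [0:1:0] and [0:0:1], whose only indeterminacy point is [1:0:0]. *)
Definition fstep (C : fieldType) (a0 a1 b2 : C) (q : C * option C)
    : option (C * option C) :=
  match q with
  | (x, None) => Some (hmap a0 a1 x, Some b2)
  | (x, Some y) =>
      if y == 0 then
        if x == 0 then None else Some (hmap a0 a1 x, None)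
      else Some (hmap a0 a1 x, Some (b2 + x / y))
  end.

(** f^p (a0, b2) = (0, 0). *)
Definition reaches_origin (C : fieldType) (a0 a1 b2 : C) (p : nat) : Prop :=
  iter p (obind (fstep a0 a1 b2)) (Some (a0, Some b2)) = Some (0, Some 0).

(* Main.v *)
(* Over the line x = const, f is the Moebius map y |-> b + x / y, so f^n acts on
   the line over x by a product M_n(x) of n matrices [[b, x], [1, 0]] taken along
   x, h x, ..., h^(n-1) x; only the matrix at x = 0 is singular, with kernel
   (0, 1) and image (b, 1).

   If the orbit of (a0, b) reaches (0, 0) after p steps, then h has order p + 1,
   the trace of M_(p+1) is an h-invariant polynomial of degree at most p which
   vanishes at 0, hence is zero, and M_(p+1)^2 is scalar by Cayley-Hamilton.

   If it never does, M_n(x) never vanishes, and for a suitable constant y0 the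
   image of the line y = y0 under f^n is a graph y = u(x) / v(x) with u and v
   coprime and deg u growing with n. Suppose that V = N / D is preserved and has
   degree d > 0 in y. On a generic line a generic level of V has d distinct
   points, so counting degrees shows V \o f = phi \o V for a Moebius map phi
   which does not depend on the line. Then u / v is a root of a polynomial in y
   whose coefficients have degree in x at most 2 max(deg_x N, deg_x D), and the
   rational root theorem bounds deg u independently of n, a contradiction. So V
   is a function of x alone. *)
From HB Require Import structures.
Require Import Defs.
From mathcomp Require Import all_boot all_order all_algebra separable.
From mathcomp Require Import reals complex.
From mathcomp Require Import polyXY fraction generic_quotient ring zify.

Set Implicit Arguments.
Unset Strict Implicit.
Unset Printing Implicit Defensive.

Import GRing.Theory Num.Theory.

Local Open Scope ring_scope.

(** * Rational functions and substitution *)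

Section RationalFunctions.

Variable C : fieldType.
Implicit Types (N D P : {poly {poly C}}) (V W r : ratfun C) (p q : C * C).

HB.instance Definition _ :=
  GRing.isZmodMorphism.Build {poly {poly C}} (ratfun C) (@polyF C)
    (@tofrac_is_zmod_morphism _).
HB.instance Definition _ :=
  GRing.isMonoidMorphism.Build {poly {poly C}} (ratfun C) (@polyF C)
    (@tofrac_is_monoid_morphism _).

Lemma cst_is_zmod_morphism : zmod_morphism (@cst C).
Proof. by move=> a b; rewrite /cst !rmorphB. Qed.

Lemma cst_is_monoid_morphism : monoid_morphism (@cst C).
Proof. by split=> [|a b]; rewrite /cst ?rmorph1 // !rmorphM. Qed.

HB.instance Definition _ :=
  GRing.isZmodMorphism.Build C (ratfun C) (@cst C) cst_is_zmod_morphism.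
HB.instance Definition _ :=
  GRing.isMonoidMorphism.Build C (ratfun C) (@cst C) cst_is_monoid_morphism.

Lemma polyFD P N : polyF (P + N) = polyF P + polyF N.
Proof. exact: rmorphD. Qed.

Lemma polyFB P N : polyF (P - N) = polyF P - polyF N.
Proof. exact: rmorphB. Qed.

Lemma polyFM P N : polyF (P * N) = polyF P * polyF N.
Proof. exact: rmorphM. Qed.

Lemma polyFX P n : polyF (P ^+ n) = polyF P ^+ n.
Proof. exact: rmorphXn. Qed.

Lemma polyF_eq0 P : (polyF P == 0) = (P == 0).
Proof. exact: tofrac_eq0. Qed.

Lemma polyF_inj : injective (@polyF C).
Proof.
by move=> P Q e; apply/eqP; rewrite -subr_eq0 -polyF_eq0 rmorphB /= e subrr.
Qed.

(** The fraction field is a quotient of pairs by cross-multiplication; this gives access to the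
    definitions that go through [repr]. *)
Lemma ratfun_numden V : V = polyF \n_(repr V) / polyF \d_(repr V).
Proof.
have d0 : polyF \d_(repr V) != 0 by rewrite polyF_eq0; exact: denom_ratioP.
apply: (canRL (mulfK d0)); rewrite -[V in V * _]reprK.
apply/eqP; rewrite /polyF; unlock FracField.tofrac.
rewrite -[X in X == _]FracField.pi_mul FracField.equivf_def /FracField.mulf.
by rewrite !numden_Ratio ?mulf_neq0 ?oner_eq0 ?denom_ratioP // !mulr1 mulrC.
Qed.

Lemma ratfunP V : exists N D, D != 0 /\ V = polyF N / polyF D.
Proof.
exists \n_(repr V), \d_(repr V); split; [exact: denom_ratioP|exact: ratfun_numden].
Qed.

Lemma polyF_div_eq N D N' D' : D != 0 -> D' != 0 ->
  polyF N / polyF D = polyF N' / polyF D' -> N * D' = N' * D.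
Proof.
move=> D0 D0' /eqP; rewrite eqr_div ?polyF_eq0 // -!rmorphM => /eqP.
exact: polyF_inj.
Qed.

Lemma hornerXYM N D (a b : C) : (N * D).[a, b] = N.[a, b] * D.[a, b].
Proof. by rewrite !hornerM. Qed.

(** Two representations satisfy N D' = N' D, also after evaluation at p; a finite value against
    infinity would make a product of two nonzero scalars vanish. *)
Lemma takes_uniq V p v w : takes V p v -> takes V p w -> v = w.
Proof.
move=> [N [D [D0 -> tv]]] [N' [D' [D0' /(polyF_div_eq D0 D0') e tw]]].
have {}e : N.[p.1, p.2] * D'.[p.1, p.2] = N'.[p.1, p.2] * D.[p.1, p.2].
  by rewrite -!hornerXYM e.
case: v tv => [v|] []; case: w tw => [w|] [].
- move=> dw <- dv <-; congr Some; apply/eqP.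
  by rewrite eqr_div // e.
- move=> dw nw dv _; move/eqP: e; rewrite dw mulr0 eq_sym.
  by rewrite mulf_eq0 (negPf nw) (negPf dv).
- move=> dw _ dv nv; move/eqP: e; rewrite dv mulr0.
  by rewrite mulf_eq0 (negPf nv) (negPf dw).
- by [].
Qed.

Lemma takes_polyF P p : takes (polyF P) p (Some P.[p.1, p.2]).
Proof.
by exists P, 1; rewrite oner_neq0 rmorph1 divr1 !hornerE divr1 oner_neq0.
Qed.

Lemma takes_cst c p : takes (cst c) p (Some c).
Proof. by have := takes_polyF c%:P%:P p; rewrite !hornerE. Qed.

Lemma takes_x p : takes (xF C) p (Some p.1).
Proof. by have := takes_polyF 'X p; rewrite !hornerE. Qed.

Lemma takes_y p : takes (yF C) p (Some p.2).
Proof. by have := takes_polyF 'Y p; rewrite !hornerE. Qed.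

Lemma takes_add V W p (v w : C) : takes V p (Some v) -> takes W p (Some w) ->
  takes (V + W) p (Some (v + w)).
Proof.
move=> [N [D [D0 -> [dv <-]]]] [N' [D' [D0' -> [dw <-]]]].
exists (N * D' + N' * D), (D * D'); split; rewrite ?mulf_neq0 //.
- by rewrite addf_div ?polyF_eq0 // rmorphD !rmorphM.
- rewrite hornerD hornerD !hornerXYM mulf_neq0 //; split=> //.
  by rewrite addf_div.
Qed.

Lemma takes_mul V W p (v w : C) : takes V p (Some v) -> takes W p (Some w) ->
  takes (V * W) p (Some (v * w)).
Proof.
move=> [N [D [D0 -> [dv <-]]]] [N' [D' [D0' -> [dw <-]]]].
exists (N * N'), (D * D'); split; rewrite ?mulf_neq0 //.
- by rewrite mulf_div !rmorphM.
- by rewrite !hornerXYM mulf_neq0 // mulf_div.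
Qed.

(** The point [a : b] of the projective line, meaningful when a and b are not both zero. *)
Definition proj_div (a b : C) : option C :=
  if b == 0 then None else Some (a / b).

Lemma takes_frac N D p : D != 0 ->
  (N.[p.1, p.2] != 0) || (D.[p.1, p.2] != 0) ->
  takes (polyF N / polyF D) p (proj_div N.[p.1, p.2] D.[p.1, p.2]).
Proof.
move=> D0 nd; exists N, D; rewrite /proj_div.
case: (eqVneq D.[p.1, p.2] 0) nd => [d0|d0] //.
by rewrite orbF.
Qed.

Lemma takes_divP V W p (v w : C) : W != 0 -> (v != 0) || (w != 0) ->
  takes V p (Some v) -> takes W p (Some w) -> takes (V / W) p (proj_div v w).
Proof.
move=> W0 vw [N [D [D0 e [dv ev]]]] [N' [D' [D0' e' [dw ew]]]].
have N0' : N' != 0.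
  by move: W0; rewrite e' mulf_eq0 invr_eq0 !polyF_eq0 (negPf D0') orbF.
have -> : V / W = polyF (N * D') / polyF (D * N').
  by rewrite e e' invf_div mulf_div !rmorphM.
have wE : (w == 0) = (N'.[p.1, p.2] == 0).
  by rewrite -ew mulf_eq0 invr_eq0 (negPf dw) orbF.
have vE : (v == 0) = (N.[p.1, p.2] == 0).
  by rewrite -ev mulf_eq0 invr_eq0 (negPf dv) orbF.
have -> : proj_div v w = proj_div (N * D').[p.1, p.2] (D * N').[p.1, p.2].
  rewrite /proj_div !hornerXYM mulf_eq0 (negPf dv) wE /=.
  by case: eqP => // _; rewrite -ev -ew invf_div mulf_div.
apply: takes_frac; first by rewrite mulf_neq0.
by rewrite !hornerXYM !mulf_eq0 (negPf dv) (negPf dw) orbF /= -vE -wE.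
Qed.

Lemma takes_div V W p (v w : C) : W != 0 -> w != 0 ->
  takes V p (Some v) -> takes W p (Some w) -> takes (V / W) p (Some (v / w)).
Proof.
move=> W0 w0 tv tw; have := takes_divP W0 _ tv tw.
by rewrite /proj_div w0 (negPf w0) orbT; apply.
Qed.

Lemma takes_cstM c V p v : c != 0 -> takes V p v ->
  takes (cst c * V) p (omap ( *%R c) v).
Proof.
move=> c0; case: v => [v|] tv; first exact/takes_mul/tv/takes_cst.
case: tv => [N [D [D0 -> [d0 n0]]]].
exists (c%:P%:P * N), D; rewrite rmorphM mulrA; split=> //; split=> //.
by rewrite !hornerE mulf_neq0.
Qed.

End RationalFunctions.

(** * Pullback of rational functions by dominant maps *)

Section Substitution.

Variable C : fieldType.
Implicit Types (N D P : {poly {poly C}}) (V W r : ratfun C) (p q : C * C).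
Implicit Types F G : ratmap C.

Lemma subst_polyD G P Q :
  subst_poly (P + Q) G = subst_poly P G + subst_poly Q G.
Proof. by rewrite /subst_poly rmorphD !hornerE. Qed.

Lemma subst_polyM G P Q :
  subst_poly (P * Q) G = subst_poly P G * subst_poly Q G.
Proof. by rewrite /subst_poly rmorphM !hornerE. Qed.

Lemma subst_poly1 G : subst_poly 1 G = 1.
Proof. by rewrite /subst_poly rmorph1 !hornerE. Qed.

Lemma subst_polyC G (c : C) : subst_poly c%:P%:P G = cst c.
Proof. by rewrite /subst_poly !map_polyC /= map_polyC !hornerC. Qed.

Lemma subst_polyX G : subst_poly 'X G = G.1.
Proof. by rewrite /subst_poly map_polyX hornerX hornerC. Qed.

Lemma subst_polyY G : subst_poly 'Y G = G.2.
Proof. by rewrite /subst_poly !map_polyC /= map_polyX hornerC hornerX. Qed.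

Lemma polyXY_ind (K : {poly {poly C}} -> Prop) :
  (forall c, K c%:P%:P) -> K 'X -> K 'Y ->
  (forall P Q, K P -> K Q -> K (P + Q)) ->
  (forall P Q, K P -> K Q -> K (P * Q)) -> forall P, K P.
Proof.
move=> Kc KX KY KD KM; have K1 (c : {poly C}) : K c%:P.
  elim/poly_ind: c => [|c a IH]; first exact: (Kc 0).
  by rewrite rmorphD rmorphM /=; apply/KD/Kc/KM.
elim/poly_ind => [|P c IH]; first exact: (Kc 0).
by apply/KD/K1/KM.
Qed.

Lemma subst_poly_takes G p q P : maps_to G p q ->
  takes (subst_poly P G) p (Some P.[q.1, q.2]).
Proof.
move=> [t1 t2]; elim/polyXY_ind: P => [c|||P Q tP tQ|P Q tP tQ].
- by rewrite subst_polyC !hornerE; apply: takes_cst.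
- by rewrite subst_polyX !hornerE.
- by rewrite subst_polyY !hornerE.
- by rewrite subst_polyD !hornerE; apply: takes_add.
- by rewrite subst_polyM !hornerE; apply: takes_mul.
Qed.

(** Dominance in algebraic form: pullback is injective on polynomials, so denominators stay
    nonzero. *)
Definition dominant G := forall P, subst_poly P G = 0 -> P = 0.

Section Dominant.

Variables (G : ratmap C) (domG : dominant G).

Lemma subst_poly_neq0 P : P != 0 -> subst_poly P G != 0.
Proof. by apply: contra_neq; exact: domG. Qed.

(** Pulling back the cross-multiplied identity between N / D and the canonical representative shows
    that the choice of fraction is immaterial. *)
Lemma subst_frac N D : D != 0 ->
  subst (polyF N / polyF D) G = subst_poly N G / subst_poly D G.
Proof.
move=> D0; rewrite /subst; set V := polyF N / polyF D.
have d0 : \d_(repr V) != 0 by exact: denom_ratioP.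
apply/eqP; rewrite eqr_div ?subst_poly_neq0 //.
rewrite -!subst_polyM.
by rewrite -(polyF_div_eq D0 d0 (ratfun_numden V)).
Qed.

Lemma subst_polyF P : subst (polyF P) G = subst_poly P G.
Proof.
rewrite -[polyF P]divr1 -(rmorph1 (@polyF C)) subst_frac ?oner_eq0 //.
by rewrite subst_poly1 divr1.
Qed.

Lemma substM V W : subst (V * W) G = subst V G * subst W G.
Proof.
have [N [D [D0 ->]]] := ratfunP V; have [N' [D' [D0' ->]]] := ratfunP W.
rewrite mulf_div -!rmorphM !subst_frac ?mulf_neq0 //.
by rewrite !subst_polyM /= mulf_div.
Qed.

Lemma substD V W : subst (V + W) G = subst V G + subst W G.
Proof.
have [N [D [D0 ->]]] := ratfunP V; have [N' [D' [D0' ->]]] := ratfunP W.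
rewrite addf_div ?polyF_eq0 // -!rmorphM -rmorphD !subst_frac ?mulf_neq0 //.
rewrite subst_polyD !subst_polyM.
by rewrite addf_div ?subst_poly_neq0.
Qed.

Lemma subst_cst c : subst (cst c) G = cst c.
Proof. by rewrite subst_polyF subst_polyC. Qed.

Lemma subst_x : subst (xF C) G = G.1.
Proof. by rewrite subst_polyF subst_polyX. Qed.

Lemma subst_y : subst (yF C) G = G.2.
Proof. by rewrite subst_polyF subst_polyY. Qed.

Lemma subst_is_zmod_morphism : zmod_morphism (fun V => subst V G).
Proof.
move=> V W; apply/eqP; rewrite eq_sym subr_eq -substD; apply/eqP.
by rewrite subrK.
Qed.

Lemma subst_is_monoid_morphism : monoid_morphism (fun V => subst V G).
Proof.
split; last exact: substM.
by have := subst_cst 1; rewrite rmorph1.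
Qed.

(** Taking the proof of dominance as an argument allows a ring morphism structure to be attached to
    substitution. *)
Definition subst_hom of dominant G := fun V => subst V G.
HB.instance Definition _ := GRing.isZmodMorphism.Build (ratfun C) (ratfun C)
  (subst_hom domG) subst_is_zmod_morphism.
HB.instance Definition _ := GRing.isMonoidMorphism.Build (ratfun C) (ratfun C)
  (subst_hom domG) subst_is_monoid_morphism.

Lemma substV V : subst V^-1 G = (subst V G)^-1.
Proof. exact: (fmorphV (subst_hom domG)). Qed.

Lemma substX V n : subst (V ^+ n) G = subst V G ^+ n.
Proof. exact: (rmorphXn (subst_hom domG)). Qed.

Lemma subst_eq0 V : (subst V G == 0) = (V == 0).
Proof. exact: (fmorph_eq0 (subst_hom domG)). Qed.

Lemma takes_comp V p q v : maps_to G p q -> takes V q v ->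
  takes (subst V G) p v.
Proof.
move=> pq [N [D [D0 -> tv]]]; rewrite subst_frac //.
have -> : v = proj_div N.[q.1, q.2] D.[q.1, q.2].
  rewrite /proj_div.
  by case: v tv => [v|] [d0 nE]; [rewrite (negPf d0) nE|rewrite d0 eqxx].
apply: takes_divP; rewrite ?subst_poly_neq0 //.
- by case: v tv => [v|] [d0 n0]; rewrite ?d0 ?n0 ?orbT.
- exact: subst_poly_takes.
- exact: subst_poly_takes.
Qed.

Lemma subst_poly_comp F P :
  subst_poly P (ratmap_comp F G) = subst (subst_poly P F) G.
Proof.
elim/polyXY_ind: P => [c|||P Q tP tQ|P Q tP tQ].
- by rewrite !subst_polyC subst_cst.
- by rewrite !subst_polyX.
- by rewrite !subst_polyY.
- by rewrite !subst_polyD /= substD tP tQ.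
- by rewrite !subst_polyM /= substM tP tQ.
Qed.

Lemma dominant_comp F : dominant F -> dominant (ratmap_comp F G).
Proof.
by move=> domF P; rewrite subst_poly_comp => /eqP; rewrite subst_eq0 => /eqP/domF.
Qed.

End Dominant.

Lemma subst_poly_id P : subst_poly P (ratmap_id C) = polyF P.
Proof.
elim/polyXY_ind: P => [c|||P Q tP tQ|P Q tP tQ].
- by rewrite !subst_polyC.
- by rewrite !subst_polyX.
- by rewrite !subst_polyY.
- by rewrite !subst_polyD /= tP tQ rmorphD.
- by rewrite !subst_polyM /= tP tQ rmorphM.
Qed.

Lemma dominant_id : dominant (ratmap_id C).
Proof. by move=> P; rewrite subst_poly_id => /eqP; rewrite polyF_eq0 => /eqP. Qed.

Lemma dominant_iter F m : dominant F ->
  dominant (iter m (ratmap_comp F) (ratmap_id C)).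
Proof.
by move=> domF; elim: m => [|m IH]; [exact: dominant_id|exact: dominant_comp].
Qed.

End Substitution.

(** * The linear recurrence *)

Section Recurrence.

Variables (A : comNzRingType) (a0 a1 b : A).
Implicit Types (x : A) (w : A * A).

Lemma iter_hmap n x :
  iter n (hmap a0 a1) x = iter n (hmap a0 a1) 0 + a1 ^+ n * x.
Proof.
by elim: n => [|n IH] /=; rewrite ?expr0 ?mul1r ?add0r // IH /hmap exprS; ring.
Qed.

Lemma iter_hmap0 n : iter n (hmap a0 a1) 0 = a0 * \sum_(j < n) a1 ^+ j.
Proof.
elim: n => [|n IH] /=; first by rewrite big_ord0 mulr0.
rewrite IH /hmap big_ord_recl /= expr0 mulrDr mulr1 mulrCA mulr_sumr.
by congr (_ + _ * _); apply: eq_bigr => i _; rewrite exprS.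
Qed.

Definition ystep x w : A * A := (b * w.1 + x * w.2, w.1).

(* The Moebius map y |-> b + x / y acts on y = w.1 / w.2 by [ystep x]; [yvec k x]
   is the product of the matrices of these maps along x, h x, ..., h^(k-1) x. *)
Fixpoint yvec k x w : A * A :=
  if k is k'.+1 then ystep (iter k' (hmap a0 a1) x) (yvec k' x w) else w.

Lemma yvec_add m k x w :
  yvec (m + k) x w = yvec m (iter k (hmap a0 a1) x) (yvec k x w).
Proof. by elim: m => //= m ->; rewrite -iterD. Qed.

Lemma yvec_linear k x w :
  yvec k x w = (w.1 * (yvec k x (1, 0)).1 + w.2 * (yvec k x (0, 1)).1,
                w.1 * (yvec k x (1, 0)).2 + w.2 * (yvec k x (0, 1)).2).
Proof.
elim: k => [|k IH] /=; first by rewrite !mulr0 !mulr1 add0r addr0; case: w.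
by rewrite IH /ystep /=; congr pair; ring.
Qed.

Lemma yvec_scale k x c w :
  yvec k x (c * w.1, c * w.2) = (c * (yvec k x w).1, c * (yvec k x w).2).
Proof.
rewrite yvec_linear /= [yvec k x w]yvec_linear /=.
by congr pair; ring.
Qed.

Lemma yvec0 k x : yvec k x (0, 0) = (0, 0).
Proof. by rewrite yvec_linear /= !mul0r !addr0. Qed.

(** Determinants multiply, and [[b, x], [1, 0]] has determinant - x. *)
Lemma yvec_det k x :
  (yvec k x (1, 0)).1 * (yvec k x (0, 1)).2 -
  (yvec k x (0, 1)).1 * (yvec k x (1, 0)).2 =
  \prod_(j < k) - iter j (hmap a0 a1) x.
Proof.
elim: k => [|k IH]; first by rewrite big_ord0 /= mulr1 mul0r subr0.
by rewrite big_ord_recr /= -IH; ring.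
Qed.

Definition ytrace k x := (yvec k x (1, 0)).1 + (yvec k x (0, 1)).2.

(** Let A be the matrix at x. Since h^k x = x, M_k(h x) A = A M_k(x); cancelling the regular element
    x = - det A gives equal traces, as for conjugate matrices. *)
Lemma ytrace_hmap k x : GRing.lreg x -> iter k (hmap a0 a1) x = x ->
  ytrace k (hmap a0 a1 x) = ytrace k x.
Proof.
move=> regx hk.
have E w : yvec k (hmap a0 a1 x) (ystep x w) = ystep x (yvec k x w).
  have -> : ystep x (yvec k x w) = yvec k.+1 x w by rewrite /= hk.
  by rewrite -addn1 yvec_add.
have := E (0, 1); have := E (1, 0).
rewrite !(yvec_linear k _ (ystep _ _)) /= /ytrace => -[_ e2] [e3 e4].
have {}e2 : b * (yvec k (hmap a0 a1 x) (1, 0)).2 +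
    (yvec k (hmap a0 a1 x) (0, 1)).2 = (yvec k x (1, 0)).1.
  by rewrite -e2; ring.
have -> : (yvec k (hmap a0 a1 x) (1, 0)).1 =
    b * (yvec k (hmap a0 a1 x) (1, 0)).2 + (yvec k x (0, 1)).2.
  apply: regx; have {}e4 : (yvec k x (0, 1)).1 =
      x * (yvec k (hmap a0 a1 x) (1, 0)).2 by rewrite -e4; ring.
  transitivity (b * (yvec k x (0, 1)).1 + x * (yvec k x (0, 1)).2).
    by rewrite -e3; ring.
  by rewrite e4; ring.
by rewrite -e2; ring.
Qed.

(* Cayley-Hamilton for the matrix of [yvec k x], which has trace zero. *)
Lemma yvec_sqr k x w : iter k (hmap a0 a1) x = x -> ytrace k x = 0 ->
  exists c, yvec (k + k) x w = (c * w.1, c * w.2).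
Proof.
move=> hk /eqP; rewrite addr_eq0 => /eqP tr0; rewrite yvec_add hk.
exists ((yvec k x (1, 0)).1 ^+ 2 + (yvec k x (0, 1)).1 * (yvec k x (1, 0)).2).
rewrite (yvec_linear k x (yvec k x w)) (yvec_linear k x w) /= tr0.
by congr pair; ring.
Qed.

End Recurrence.

Section RecurrenceMorphism.

Variables (A B : comNzRingType) (g : {rmorphism A -> B}) (a0 a1 b : A).

Lemma rmorph_iter_hmap n x :
  g (iter n (hmap a0 a1) x) = iter n (hmap (g a0) (g a1)) (g x).
Proof. by elim: n => //= n <-; rewrite /hmap rmorphD rmorphM. Qed.

Lemma rmorph_yvec k x w :
  yvec (g a0) (g a1) (g b) k (g x) (g w.1, g w.2) =
  (g (yvec a0 a1 b k x w).1, g (yvec a0 a1 b k x w).2).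
Proof.
by elim: k => //= k ->; rewrite /ystep /= -rmorph_iter_hmap rmorphD !rmorphM.
Qed.

Lemma rmorph_ytrace k x :
  ytrace (g a0) (g a1) (g b) k (g x) = g (ytrace a0 a1 b k x).
Proof.
by rewrite /ytrace rmorphD -[0 in LHS](rmorph0 g) -[1 in LHS](rmorph1 g)
  (rmorph_yvec _ _ (1, 0)) (rmorph_yvec _ _ (0, 1)).
Qed.

End RecurrenceMorphism.

(** * Degrees in x of the recurrence *)

Section PolyRecurrence.

Variables (C : numFieldType) (a0 a1 b : C).
Hypothesis a1_neq0 : a1 != 0.

Local Notation h := (hmap a0 a1).
Local Notation hP := (hmap a0%:P a1%:P).
Local Notation vecP := (yvec a0%:P a1%:P b%:P).

Definition hinv (x : C) := (x - a0) / a1.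

Lemma hmapK : cancel h hinv.
Proof. by move=> x; rewrite /hinv /hmap addrC addKr mulrC mulKf. Qed.

Lemma hinvK : cancel hinv h.
Proof. by move=> x; rewrite /hinv /hmap mulrC divfK // addrC subrK. Qed.

Lemma iter_hmapK n : cancel (iter n h) (iter n hinv).
Proof. by elim: n => // n IH x; rewrite iterSr /= hmapK. Qed.

Lemma iter_hinvK n : cancel (iter n hinv) (iter n h).
Proof. by elim: n => // n IH x; rewrite iterSr /= hinvK. Qed.

Lemma horner_iter_hmap n c : (iter n hP 'X).[c] = iter n h c.
Proof.
have := rmorph_iter_hmap (horner_eval c) a0%:P a1%:P n 'X.
by rewrite /= /horner_eval !hornerE.
Qed.

Lemma size_iter_hmap n : size (iter n hP 'X) = 2%N.
Proof.
have -> : iter n hP 'X = (a1 ^+ n) *: 'X + (iter n h 0)%:P.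
  rewrite iter_hmap (rmorph_iter_hmap polyC) /= addrC -mul_polyC rmorphXn.
  by rewrite rmorph0.
rewrite -mul_polyC size_MXaddC polyC_eq0 size_polyC.
by rewrite (negPf (expf_neq0 n a1_neq0)).
Qed.

Lemma horner_yvec k (w : {poly C} * {poly C}) c :
  yvec a0 a1 b k c (w.1.[c], w.2.[c]) =
  ((vecP k 'X w).1.[c], (vecP k 'X w).2.[c]).
Proof.
have := rmorph_yvec (horner_eval c) a0%:P a1%:P b%:P k 'X w.
by rewrite /= /horner_eval !hornerE.
Qed.

(** A step multiplies only the old second component by a linear polynomial and moves the first one
    down, so degrees grow by at most one every two steps. *)
Lemma size_yvec k (w : C * C) :
  (size (vecP k 'X (w.1%:P, w.2%:P)).1 <= (uphalf k).+1)%N /\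
  (size (vecP k 'X (w.1%:P, w.2%:P)).2 <= k./2.+1)%N.
Proof.
elim: k => [|k [IH1 IH2]]; first by rewrite !size_polyC; do 2!case: eqP.
rewrite /= -/(uphalf k.+1); split; last by apply: leq_trans IH1 _.
rewrite (leq_trans (size_polyD _ _)) // geq_max; apply/andP; split.
  rewrite mul_polyC (leq_trans (size_scale_leq _ _)) // (leq_trans IH1) //.
  by lia.
rewrite (leq_trans (size_polyMleq _ _)) // size_iter_hmap /=.
by rewrite add1n ltnS.
Qed.

(** By [size_yvec] the term with factor b has smaller degree than the term with the linear factor,
    so the top term never cancels. This is the degree growth that rules out a second fibration. *)
Lemma size_yvec_odd m (y : C) :
  size (vecP m.*2.+1 'X (y%:P, 1)).1 = m.+2.
Proof.
elim: m => [|m IH].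
  by rewrite /= mulr1 -rmorphM addrC size_XaddC.
rewrite doubleS -[(vecP _ _ _).1]/(b%:P * (vecP m.*2.+2 'X (y%:P, 1)).1 +
  iter m.*2.+2 hP 'X * (vecP m.*2.+1 'X (y%:P, 1)).1).
have [s1 _] := size_yvec m.*2.+2 (y, 1).
have nz : (vecP m.*2.+1 'X (y%:P, 1)).1 != 0 by rewrite -size_poly_eq0 IH.
have sz : size (iter m.*2.+2 hP 'X * (vecP m.*2.+1 'X (y%:P, 1)).1) = m.+3.
  by rewrite size_mul ?IH ?size_iter_hmap // -size_poly_eq0 size_iter_hmap.
rewrite addrC size_polyDl sz // ltnS mul_polyC.
rewrite (leq_trans (size_scale_leq _ _)) // (leq_trans s1) //.
by rewrite /= uphalf_double.
Qed.

End PolyRecurrence.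

(** * The map f *)

Section InfiniteField.

Variable C : numFieldType.

Lemma poly_nonroot (P : {poly C}) : P != 0 -> exists c, P.[c] != 0.
Proof.
move=> P0; pose rs : seq C := mkseq (fun i => i%:R) (size P).
have /allPn[c _ Pc] : ~~ all (root P) rs.
  apply/negP => /(max_poly_roots P0); rewrite size_mkseq ltnn => /(_ _)/negP[] //.
  by rewrite mkseq_uniq //; apply/mulrIn/oner_neq0.
by exists c.
Qed.

(** Multiplying P by the product of the X - z over the exceptional points makes it vanish
    everywhere. *)
Lemma poly_cofinite_eq0 (s : seq C) (P : {poly C}) :
  (forall c, c \notin s -> P.[c] = 0) -> P = 0.
Proof.
move=> Ps; apply/eqP; apply: contraT => P0.
have /poly_nonroot[c] : P * \prod_(z <- s) ('X - z%:P) != 0.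
  by rewrite mulf_neq0 // prodf_seq_neq0; apply/allP => z _; rewrite polyXsubC_eq0.
rewrite hornerM; have [cs|/Ps->] := boolP (c \in s); last by rewrite mul0r eqxx.
by have := root_prod_XsubC s c; rewrite cs => /rootP->; rewrite mulr0 eqxx.
Qed.

Lemma exists_notin (s : seq C) : exists c, c \notin s.
Proof.
have /poly_nonroot[c] : \prod_(z <- s) ('X - z%:P) != 0 :> {poly C}.
  by rewrite prodf_seq_neq0; apply/allP => z _; rewrite polyXsubC_eq0.
by rewrite -[_ == 0]/(root _ c) root_prod_XsubC; exists c.
Qed.

Lemma polyXY_cofinite_eq0 (s : seq C) (t : seq C) (P : {poly {poly C}}) :
  (forall c d, c \notin s -> d \notin t -> P.[c, d] = 0) -> P = 0.
Proof.
move=> Ps; apply: (can_inj (@swapXYK C)); rewrite raddf0.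
apply/polyP => i; rewrite coef0; apply: (@poly_cofinite_eq0 s) => c cs.
have Pc : P.[c%:P] = 0 by apply: (@poly_cofinite_eq0 t) => d; apply: Ps.
have := horner_polyC P c; rewrite Pc => e.
have := congr1 (fun p : {poly C} => p`_i) e.
by rewrite coef0 coef_map /= /horner_eval => <-.
Qed.

End InfiniteField.

Lemma fmap_step (F : fieldType) (b x u v : F) : u != 0 -> v != 0 ->
  (x + b * (u / v)) / (u / v) = (b * u + x * v) / u.
Proof. by move=> u0 v0; field; rewrite u0 v0. Qed.

Lemma divf_neq0 (F : fieldType) (u v : F) : u / v != 0 -> u != 0 /\ v != 0.
Proof. by rewrite mulf_eq0 invr_eq0 negb_or => /andP. Qed.

Section Map.

Variables (C : numFieldType) (a0 a1 b : C).
Hypothesis a1_neq0 : a1 != 0.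

Local Notation h := (hmap a0 a1).
Local Notation f := (fmap a0 a1 b).

Let yF_neq0 : yF C != 0.
Proof. by rewrite polyF_eq0 polyC_eq0 polyX_eq0. Qed.

Lemma maps_to_fmap (x y : C) : y != 0 -> maps_to f (x, y) (h x, b + x / y).
Proof.
move=> y0; split => /=.
  apply: takes_add; first exact: takes_cst.
  by apply: takes_mul; [exact: takes_cst|exact: (takes_x (x, y))].
have -> : b + x / y = (x + b * y) / y by rewrite mulrDl mulfK // addrC.
apply: takes_div => //; last exact: (takes_y (x, y)).
apply: takes_add; first exact: (takes_x (x, y)).
by apply: takes_mul; [exact: takes_cst|exact: (takes_y (x, y))].
Qed.

(** Every (c, d) with c != a0 and d != b is the image of an explicit point, so a polynomial with
    zero pullback vanishes at all of them. *)
Lemma dominant_fmap : dominant f.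
Proof.
move=> P P0; apply: (@polyXY_cofinite_eq0 _ [:: a0] [:: b]) => c d.
rewrite !inE => ca db.
have x0 : hinv a0 a1 c != 0.
  by rewrite mulf_neq0 ?invr_eq0 // subr_eq0.
have d0 : d - b != 0 by rewrite subr_eq0.
have y0 : hinv a0 a1 c / (d - b) != 0 by rewrite mulf_neq0 ?invr_eq0.
have := subst_poly_takes P (maps_to_fmap (hinv a0 a1 c) y0).
rewrite P0 /= hinvK // -(rmorph0 (@cst C)) => /takes_uniq/(_ (takes_cst _ _)).
by move=> [<-]; rewrite invf_div mulrC divfK // addrC subrK.
Qed.

Lemma subst_fmap_x : subst (xF C) f = cst a0 + cst a1 * xF C.
Proof. exact: (subst_x dominant_fmap). Qed.

Lemma subst_fmap_iter n :
  subst (iter n (hmap (cst a0) (cst a1)) (xF C)) f =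
  iter n.+1 (hmap (cst a0) (cst a1)) (xF C).
Proof.
have := rmorph_iter_hmap (subst_hom dominant_fmap) (cst a0) (cst a1) n (xF C).
rewrite /= /subst_hom => ->; rewrite !subst_cst ?subst_fmap_x;
  try exact: dominant_fmap.
by rewrite -iterSr.
Qed.

Lemma takes_iter_hmap n p :
  takes (iter n (hmap (cst a0) (cst a1)) (xF C)) p (Some (iter n h p.1)).
Proof.
elim: n => [|n IH] /=; first exact: takes_x.
apply: takes_add; first exact: takes_cst.
by apply: takes_mul => //; exact: takes_cst.
Qed.

Lemma nonconstant_hprod n : (0 < n)%N -> nonconstant (hprod a0 a1 n).
Proof.
case: n => // n _ c e.
have tn : forall p, takes (hprod a0 a1 n.+1) p (Some (\prod_(j < n.+1) iter j h p.1)).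
  move=> p; rewrite /hprod; elim: n.+1 => [|m IH].
    by rewrite !big_ord0 -(rmorph1 (@cst C)); exact: takes_cst.
  by rewrite !big_ord_recr /=; apply: takes_mul => //; exact: takes_iter_hmap.
(* The factor j = 0 is x itself, so the product vanishes at x = 0. *)
have c0 : c = 0.
  have := takes_uniq (tn (0, 0)); rewrite e => /(_ _ (takes_cst c _))[<-].
  by rewrite big_ord_recl /= mul0r.
move/eqP: e; rewrite c0 (rmorph0 (@cst C)) /hprod prodf_seq_eq0.
(* A product in a field is zero only if a factor is, but h^j takes the value 1 at the j-th preimage
   of 1. *)
case/hasP => j _ /= /eqP e; have := takes_iter_hmap j (iter j (hinv a0 a1) 1, 0).
rewrite e -(rmorph0 (@cst C)) /= iter_hinvK // => /takes_uniq/(_ (takes_cst _ _)).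
by move=> [/eqP]; rewrite oner_eq0.
Qed.

Lemma iter_cst_hmap n :
  iter n h 0 = 0 -> a1 ^+ n = 1 ->
  iter n (hmap (cst a0) (cst a1)) (xF C) = xF C.
Proof.
move=> h0 a1n; rewrite iter_hmap -[0 in LHS](rmorph0 (@cst C)).
by rewrite -rmorph_iter_hmap -rmorphXn h0 a1n rmorph0 rmorph1 add0r mul1r.
Qed.

(** Pullback by f replaces each factor h^j x by the next one; the last becomes h^n x = x, so the
    factors are permuted cyclically. *)
Lemma first_integral_hprod n : (0 < n)%N -> iter n h 0 = 0 -> a1 ^+ n = 1 ->
  first_integral f (hprod a0 a1 n).
Proof.
case: n => // n _ h0 a1n; split; first exact: nonconstant_hprod.
rewrite /hprod -[subst _ _]/(subst_hom dominant_fmap _) rmorph_prod /=.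
rewrite /subst_hom.
under eq_bigr do rewrite subst_fmap_iter.
rewrite [LHS]big_ord_recr [RHS]big_ord_recl mulrC; congr (_ * _).
exact: iter_cst_hmap.
Qed.

Lemma iter_hmap_root_of_unity n : a1 ^+ n = 1 -> a1 != 1 -> iter n h 0 = 0.
Proof.
move=> a1n a11; rewrite iter_hmap0; have := subrX1 a1 n.
rewrite a1n subrr => /esym/eqP; rewrite mulf_eq0 subr_eq0 (negPf a11) => /eqP->.
by rewrite mulr0.
Qed.

Lemma nonconstant_x : nonconstant (xF C).
Proof.
move=> c e; have := takes_x (c + 1, 0); rewrite e => t.
have [/eqP] := takes_uniq (takes_cst c _) t.
by rewrite -subr_eq0 opprD addNKr oppr_eq0 oner_eq0.
Qed.

Lemma preserves_fibration_x : preserves_fibration f (xF C).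
Proof.
split; first exact: nonconstant_x.
move=> v; exists (omap h v) => p q tp pq w tq.
have := takes_comp dominant_fmap pq tq; rewrite subst_fmap_x => t.
rewrite -(takes_uniq (takes_x p) tp) /=; apply: takes_uniq t _.
apply: takes_add; first exact: takes_cst.
by apply: takes_mul; [exact: takes_cst|exact: takes_x].
Qed.

Lemma preserves_fibration_scale (V : ratfun C) c : c != 0 -> nonconstant V ->
  subst V f = cst c * V -> preserves_fibration f V.
Proof.
move=> c0 ncV e; split=> // v; exists (omap ( *%R c) v) => p q tp pq w tq.
have := takes_comp dominant_fmap pq tq; rewrite e => t.
exact/(takes_uniq t)/takes_cstM.
Qed.

(** Here w holds homogeneous coordinates of the second component of f^k, starting from [y : 1]. *)
Lemma iter_fmap k : let w := yvec (cst a0) (cst a1) (cst b) k (xF C) (yF C, 1) in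
  [/\ iter k (ratmap_comp f) (ratmap_id C) =
        (iter k (hmap (cst a0) (cst a1)) (xF C), w.1 / w.2),
      w.1 != 0 & w.2 != 0].
Proof.
elim: k => [|k [IH w1 w2]].
  by split; [rewrite /= divr1|exact: yF_neq0|exact: oner_neq0].
have domk := dominant_iter (m := k) dominant_fmap.
have e : iter k.+1 (ratmap_comp f) (ratmap_id C) =
        (iter k.+1 (hmap (cst a0) (cst a1)) (xF C),
        (yvec (cst a0) (cst a1) (cst b) k.+1 (xF C) (yF C, 1)).1 /
        (yvec (cst a0) (cst a1) (cst b) k.+1 (xF C) (yF C, 1)).2).
  rewrite /= [in LHS]/ratmap_comp /= !substM // !substD // !substM //.
  rewrite !substV // !subst_cst // !subst_x // !subst_y // IH /=.
  rewrite (fmap_step _ _ w1 w2).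
  by rewrite /hmap.
(* The pullback of y by the dominant map f^(k+1) is nonzero; as division by zero gives zero, both
   coordinates are nonzero. *)
have := subst_poly_neq0 (dominant_iter (m := k.+1) dominant_fmap) (P := 'Y).
rewrite polyC_eq0 polyX_eq0 subst_polyY (congr1 snd e) => /(_ isT).
case/divf_neq0 => u0 v0; exact: And3 e u0 v0.
Qed.

Lemma periodic_fmap m : a1 ^+ m = 1 -> iter m h 0 = 0 ->
  (exists c, yvec (cst a0) (cst a1) (cst b) m (xF C) (yF C, 1) =
    (c * yF C, c)) ->
  periodic m f.
Proof.
move=> a1m h0 [c e]; have [] := iter_fmap m; rewrite e /= => e1 _ c0.
by rewrite /periodic e1 iter_cst_hmap // [c * _]mulrC mulfK.
Qed.

End Map.

(** * Orbits through the origin *)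

Section Orbit.

Variables (C : numFieldType) (a0 a1 b : C).

Local Notation h := (hmap a0 a1).
Local Notation orbit k :=
  (iter k (obind (fstep a0 a1 b)) (Some (a0, Some b))).

(** The vector w gives homogeneous coordinates of z, infinity being [1 : 0]; in particular w is
    nonzero. *)
Definition represents (z : option C) (w : C * C) : Prop :=
  if z is Some y then w.2 != 0 /\ w.1 = y * w.2 else w.1 != 0 /\ w.2 = 0.

Lemma orbit_yvec k c z : orbit k = Some (c, z) ->
  c = iter k h a0 /\ represents z (yvec a0 a1 b k a0 (b, 1)).
Proof.
elim: k c z => [|k IH] c z /=.
  by case=> <- <-; rewrite /= oner_neq0 mulr1.
case: (orbit k) IH => [[c' z']|] //= /(_ _ _ erefl)[-> {c'}].
case: z' => [y|] /= [w1 w2].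
  have [y0|y0] := eqVneq y 0.
    case: eqP => // /eqP c0 [<- <-] /=; split=> //.
    by rewrite w2 y0 !mul0r mulr0 add0r mulf_neq0.
  case=> <- <- /=; do 2!split=> //; first by rewrite w2 mulf_neq0.
  by rewrite w2 mulrDl; congr (_ + _); rewrite mulrA divfK.
by case=> <- <- /=; rewrite w2 mulr0 addr0.
Qed.

Lemma orbit_total : (forall k, ~ reaches_origin a0 a1 b k) ->
  forall k, exists z, orbit k = Some (iter k h a0, z).
Proof.
move=> nr k; suff [[c z] e] : exists q, orbit k = Some q.
  by have [<- _] := orbit_yvec e; exists z.
elim: k => [|k [[c z] IH]]; first by exists (a0, Some b).
move: (nr k); rewrite /reaches_origin /= IH /=.
case: z {IH} => [y|] /=; last by eexists.
case: eqVneq => [->|_]; last by eexists.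
by case: eqVneq => [-> /(_ erefl)|_ _]; last by eexists.
Qed.

Lemma yvec_orbit_neq0 : (forall k, ~ reaches_origin a0 a1 b k) ->
  forall k, yvec a0 a1 b k a0 (b, 1) <> (0, 0).
Proof.
move=> nr k e; have [z /orbit_yvec[_]] := orbit_total nr k.
by rewrite e; case: z => [y|] /= []; rewrite eqxx.
Qed.

Lemma orbit_stop k p : (k <= p)%N -> orbit k = None -> orbit p = None.
Proof. by move=> /subnK<-; rewrite iterD => ->; elim: (p - k)%N => //= n ->. Qed.

(** The line x = 0, apart from the origin, is collapsed to (a0, b). A visit to it at time j < p
    would restart the orbit, which would then reach the origin too early and stop before time p + 1
    - that is, by time p - j. *)
Lemma reaches_origin_first j p : reaches_origin a0 a1 b p -> (j < p)%N ->
  iter j h a0 != 0.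
Proof.
rewrite /reaches_origin => rp jp; apply/eqP => j0.
have np k : (k <= p)%N -> orbit k != None.
  by move=> kp; apply/eqP => /(orbit_stop kp); rewrite rp.
case e : (orbit j) (np j (ltnW jp)) => [[c z]|] // _.
have [cE _] := orbit_yvec e.
have ej : orbit j.+1 = Some (a0, Some b).
  move: (np j.+1 jp); rewrite /= e /= cE j0 /hmap mulr0 addr0.
  rewrite [0 == 0]eqxx; case: z {e} => [y|] //.
  by case: (y == 0); rewrite ?eqxx // mul0r addr0.
have := rp; rewrite -(subnK jp) iterD ej => rj.
have := np (p - j.+1).+1; rewrite [orbit _.+1]/= rj /= eqxx eqxx -subSn //.
by rewrite subSS leq_subr => /(_ isT).
Qed.

Lemma reaches_originP p : reaches_origin a0 a1 b p ->
  iter p h a0 = 0 /\ (yvec a0 a1 b p a0 (b, 1)).1 = 0.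
Proof. by move=> /orbit_yvec[<- [_ ->]]; rewrite mul0r. Qed.

Hypothesis a1_neq0 : a1 != 0.

(** Since h 0 = a0 and h^p a0 = 0, the point 0 is periodic. As h^(p+1) 0 is a0 times a geometric sum
    and a0 != 0, that sum is zero, whence a1^(p+1) = 1. *)
Lemma reaches_origin_period p : (0 < p)%N -> reaches_origin a0 a1 b p ->
  iter p.+1 h 0 = 0 /\ a1 ^+ p.+1 = 1.
Proof.
move=> p0 rp; have [hp _] := reaches_originP rp.
have e : iter p.+1 h 0 = 0 by rewrite iterSr /hmap mulr0 addr0.
split=> //; have a00 : a0 != 0 := reaches_origin_first rp p0.
move/eqP: e; rewrite iter_hmap0 mulf_eq0 (negPf a00) /= => /eqP e.
by apply/eqP; rewrite -subr_eq0 subrX1 e mulr0.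
Qed.

(* The trace is a polynomial in x of degree at most (p + 2) / 2, invariant under
   the (p + 1)-periodic map h, so it vanishes on the orbit of 0 as soon as it
   vanishes at 0. *)
Lemma reaches_origin_ytrace p : (0 < p)%N -> reaches_origin a0 a1 b p ->
  ytrace a0%:P a1%:P b%:P p.+1 ('X : {poly C}) = 0.
Proof.
move=> p0 rp; have [h0 a1n] := reaches_origin_period p0 rp.
set T := ytrace _ _ _ _ _.
have TE c : T.[c] = ytrace a0 a1 b p.+1 c.
  have := rmorph_ytrace (horner_eval c) a0%:P a1%:P b%:P p.+1 'X.
  by rewrite /= /horner_eval !hornerE => ->.
(* The first matrix at x = 0 sends w to w.1 times (b, 1), so the trace there is the first coordinate
   of the vector carried along the orbit of (a0, b), zero at time p. *)
have T0 : T.[0] = 0.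
  have E w : yvec a0 a1 b p.+1 0 w = yvec a0 a1 b p a0 (b * w.1, w.1).
    by rewrite -addn1 yvec_add /= /ystep /hmap mulr0 mul0r !addr0.
  rewrite TE /ytrace !E /= mulr0 mulr1 yvec0 addr0.
  by have [_] := reaches_originP rp.
have Th c : T.[h c] = T.[c].
  have hX : iter p.+1 (hmap a0%:P a1%:P) 'X = 'X.
    rewrite iter_hmap -[0 in LHS](rmorph0 polyC).
    by rewrite -rmorph_iter_hmap -rmorphXn h0 a1n rmorph0 rmorph1 add0r mul1r.
  have X0 : 'X != 0 :> {poly C} by rewrite polyX_eq0.
  have := ytrace_hmap b%:P (mulfI X0) hX.
  move/(congr1 (horner_eval c)); rewrite -!rmorph_ytrace /= /horner_eval.
  by rewrite !TE /hmap !hornerE.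
have Tk k : T.[iter k h 0] = 0 by elim: k => [|k IH] //=; rewrite Th.
(* A coincidence h^i 0 = h^j 0 gives h^(j-i-1) a0 = 0, before time p. *)
have inj i j : (i < j)%N -> (j <= p)%N -> iter i h 0 <> iter j h 0.
  move=> ij jp; rewrite -(subnKC (ltnW ij)) iterD => /(can_inj (iter_hmapK a0 a1_neq0 _)).
  rewrite -(prednK (n := j - i)) ?subn_gt0 // iterSr.
  rewrite (_ : h 0 = a0); last by rewrite /hmap mulr0 addr0.
  move/esym/eqP; apply/negP/(reaches_origin_first rp).
  by move: ij jp; lia.
apply/eqP; apply: contraT => Tn0.
have := max_poly_roots Tn0 (rs := mkseq (fun k => iter k h 0) p.+1).
rewrite size_mkseq => rT.
(* The p + 1 distinct roots exceed the degree, which is at most p because p > 0. *)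
suff sT : (size T <= p.+1)%N.
  rewrite ltnNge sT in rT; apply: rT.
- by apply/allP => _ /mapP[k _ ->]; apply/rootP/Tk.
- rewrite map_inj_in_uniq ?iota_uniq // => i j; rewrite !mem_iota !add0n /= !ltnS.
  move=> ip jp; case: (ltngtP i j) => // ij e; first by case: (inj i j).
  by case: (inj j i).
have [s1 _] := size_yvec a0 b a1_neq0 p.+1 (1, 0).
have [_ s2] := size_yvec a0 b a1_neq0 p.+1 (0, 1).
rewrite (leq_trans (size_polyD _ _)) // geq_max.
rewrite !polyC0 !polyC1 in s1 s2.
rewrite (leq_trans s1) /= 1?(leq_trans s2) //=; move: p0; lia.
Qed.

Lemma periodic_reaches_origin p : (0 < p)%N -> reaches_origin a0 a1 b p ->
  periodic (2 * p + 2) (fmap a0 a1 b) /\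
  first_integral (fmap a0 a1 b) (hprod a0 a1 (2 * p + 2)).
Proof.
move=> p0 rp; have [h0 a1n] := reaches_origin_period p0 rp.
have -> : (2 * p + 2 = p.+1 + p.+1)%N by lia.
have a1m : a1 ^+ (p.+1 + p.+1) = 1 by rewrite exprD a1n mulr1.
have h0m : iter (p.+1 + p.+1) h 0 = 0 by rewrite iterD !h0.
split; last exact: first_integral_hprod.
apply: periodic_fmap => //; set x := xF C.
pose g : {rmorphism {poly C} -> ratfun C} := @polyF C \o map_poly polyC.
have gC c : g c%:P = cst c by rewrite /g /= map_polyC.
have gX : g 'X = x by rewrite /g /= map_polyX.
have tr0 : ytrace (cst a0) (cst a1) (cst b) p.+1 x = 0.
  by rewrite -!gC -gX rmorph_ytrace (reaches_origin_ytrace p0 rp) rmorph0.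
have [c ->] := yvec_sqr (yF C, 1) (iter_cst_hmap h0 a1n) tr0.
by exists c; rewrite mulr1.
Qed.

End Orbit.

(** * The case (a0, b) = (0, 0) *)

Lemma power_rule_step (A : comPzRingType) (k q u v : A) :
  q * (u * v) + u * (k * v * q) = (k + 1) * (u * v) * q.
Proof. by ring. Qed.

(** * Derivations of the function field *)

Section Derivations.

Variables (C : fieldType) (d : {poly {poly C}} -> {poly {poly C}}).
Hypothesis dM : forall P Q, d (P * Q) = d P * Q + P * d Q.
Implicit Types (N D P : {poly {poly C}}) (V W : ratfun C).

(** The derivative does not depend on the fraction: N e = n D together with its image under d gives
    the cross-multiplied identity. *)
Lemma quotient_rule_frac N D : D != 0 ->
  quotient_rule d (polyF N / polyF D) = polyF (d N * D - N * d D) / polyF D ^+ 2.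
Proof.
move=> D0; rewrite /quotient_rule; set V := polyF N / polyF D.
have := ratfun_numden V; have := denom_ratioP (repr V).
set n := \n_(repr V); set e := \d_(repr V) => e0 /(polyF_div_eq D0 e0) E.
apply/eqP; rewrite -!polyFX eqr_div ?polyF_eq0 ?expf_neq0 // -!polyFM.
apply/eqP; congr (polyF _).
have dE : d N * e + N * d e = d n * D + n * d D by rewrite -!dM E.
transitivity ((d n * D + n * d D) * (D * e) - (n * D) * (d e * D + e * d D));
  first by ring.
rewrite -dE -E.
by ring.
Qed.

Lemma quotient_ruleM V W :
  quotient_rule d (V * W) = quotient_rule d V * W + V * quotient_rule d W.
Proof.
have [N [D [D0 ->]]] := ratfunP V; have [N' [D' [D0' ->]]] := ratfunP W.
rewrite mulf_div -!polyFM !quotient_rule_frac ?mulf_neq0 //.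
rewrite !mulf_div -!polyFX -!polyFM addf_div ?polyF_eq0 ?mulf_neq0 ?expf_neq0 //.
rewrite -!polyFM -polyFD; apply/eqP.
rewrite eqr_div ?polyF_eq0 ?mulf_neq0 ?expf_neq0 // -!polyFM !dM.
by apply/eqP; congr (polyF _); ring.
Qed.

Lemma quotient_ruleX V n :
  quotient_rule d (V ^+ n.+1) = n.+1%:R * V ^+ n * quotient_rule d V.
Proof.
elim: n => [|n IH]; first by rewrite expr1 expr0 !mul1r.
rewrite exprS quotient_ruleM IH -[in RHS]natr1 exprS.
exact: power_rule_step.
Qed.

End Derivations.

Lemma fib_step (F : fieldType) (t x y : F) : x != 0 -> y != 0 ->
  t * (x / y) + t ^+ 2 * x * (y / x) = t * (t * y + x / y).
Proof. by move=> x0 y0; field; rewrite x0 y0. Qed.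

Lemma jacobian_step (F : fieldType) (s x y : F) : y != 0 ->
  y^-1 * (- s - x / y ^+ 2) - (s - x / y ^+ 2) * y^-1 = - (s + s) / y.
Proof. by move=> y0; field; rewrite y0. Qed.

Lemma jacobian_powers (F : comPzRingType) (k u v a b c d : F) :
  k * u * a * (k * v * d) - k * u * b * (k * v * c) =
  k * k * (u * v) * (a * d - b * c).
Proof. by ring. Qed.

Lemma dY_fib_step (F : fieldType) (t x y : F) : y != 0 ->
  (t * y ^+ 2 - x) / y ^+ 2 = t - x / y ^+ 2.
Proof. by move=> y0; field; rewrite y0. Qed.

(** When a0 = b = 0, two consecutive matrices multiply to x times diag(a1, 1), so each double step
    scales the ratio of the coordinates by a1. *)
Lemma yvec_even (A : comNzRingType) (a1 x : A) n w :
  exists c, yvec 0 a1 0 (2 * n) x w = (c * a1 ^+ n * w.1, c * w.2).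
Proof.
elim: n => [|n [c IH]]; first by exists 1; rewrite muln0 !mul1r; case: w.
exists (iter (2 * n) (hmap 0 a1) x * c).
rewrite mulnS addnC addn2 /= IH /ystep /= exprS /hmap.
by congr pair; ring.
Qed.

Lemma takes_exp (C : fieldType) (V : ratfun C) p (v : C) n :
  takes V p (Some v) -> takes (V ^+ n) p (Some (v ^+ n)).
Proof.
move=> t; elim: n => [|n IH]; last by rewrite !exprS; apply: takes_mul.
by rewrite !expr0 -(rmorph1 (@cst C)); exact: takes_cst.
Qed.

Section TwoFibrations.

Variables (C : numFieldType) (a1 s : C).
Hypothesis a1_neq0 : a1 != 0.
Hypothesis s2 : s ^+ 2 = a1.

Local Notation f := (fmap 0 a1 0).
Local Notation x := (xF C).
Local Notation y := (yF C).

Lemma dpolyXM P Q : dpolyX (P * Q) = dpolyX P * Q + P * dpolyX Q :> {poly {poly C}}.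
Proof. exact: derivM. Qed.

(** Exchanging the variables transfers the product rule from x to y. *)
Lemma dpolyYE P : dpolyY P = swapXY (swapXY P)^`() :> {poly {poly C}}.
Proof.
apply/polyP => i; apply/polyP => j.
by rewrite coef_map coef_swapXY !coef_deriv coefMn coef_swapXY.
Qed.

Lemma dpolyYM P Q : dpolyY (P * Q) = dpolyY P * Q + P * dpolyY Q :> {poly {poly C}}.
Proof. by rewrite !dpolyYE rmorphM /= derivM rmorphD !rmorphM /= !swapXYK. Qed.

Lemma s_neq0 : s != 0.
Proof. by move: a1_neq0; rewrite -s2; apply: contra_neq => ->; rewrite expr0n. Qed.

Lemma fmap00 : f = (cst a1 * x, x / y).
Proof. by rewrite /fmap !(rmorph0 (@cst C)) add0r mul0r addr0. Qed.

(** One family for both fibrations, t = s and t = - s; invariance uses only t^2 = a1. *)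
Definition fib (t : C) : ratfun C := cst t * y + x / y.

Lemma y_neq0 : y != 0.
Proof. by rewrite polyF_eq0 polyC_eq0 polyX_eq0. Qed.

Lemma x_neq0 : x != 0.
Proof. by rewrite polyF_eq0 polyX_eq0. Qed.

Lemma fibE t : fib t = polyF (t%:P%:P * 'Y ^+ 2 + 'X) / polyF 'Y.
Proof.
rewrite /fib polyFD polyFM polyFX mulrDl -mulrA expr2 mulfK //.
exact: y_neq0.
Qed.

Lemma subst_fib t : t ^+ 2 = a1 -> subst (fib t) f = cst t * fib t.
Proof.
move=> t2; have dom := @dominant_fmap C 0 a1 0 a1_neq0.
rewrite /fib substD // !substM // substV // subst_cst // subst_x // subst_y //.
rewrite fmap00 /= -t2 (rmorphXn (@cst C)) invf_div.
exact: fib_step x_neq0 y_neq0.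
Qed.

Lemma dX_fib t : dX (fib t) = polyF 1 / polyF 'Y.
Proof.
rewrite fibE /dX (quotient_rule_frac dpolyXM) ?polyC_eq0 ?polyX_eq0 //.
rewrite /dpolyX derivD derivX -polyC_exp -polyCM !derivC add0r mulr0 subr0.
apply/eqP; rewrite eqr_div -?polyFX ?polyF_eq0 ?expf_neq0 ?polyC_eq0 ?polyX_eq0 //.
by rewrite -!polyFM !mul1r expr2.
Qed.

Lemma dY_fib t :
  dY (fib t) = polyF (t%:P%:P * 'Y ^+ 2 - 'X) / polyF ('Y ^+ 2).
Proof.
rewrite fibE /dY (quotient_rule_frac dpolyYM) ?polyC_eq0 ?polyX_eq0 //.
rewrite polyFX; congr (polyF _ / _); rewrite !dpolyYE.
rewrite rmorphD rmorphM rmorphXn /=.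
rewrite !swapXY_Y swapXY_X swapXY_polyC map_polyC /= derivD derivC addr0.
rewrite derivM derivC mul0r add0r derivXn derivX rmorphM rmorph1 /=.
rewrite swapXY_polyC map_polyC /= rmorphMn /= swapXY_X.
by ring.
Qed.

Lemma takes_fib t p : p.2 != 0 -> takes (fib t) p (Some (t * p.2 + p.1 / p.2)).
Proof.
move=> p0; apply: takes_add; first by apply: takes_mul; [exact: takes_cst|exact: takes_y].
by apply: takes_div => //; [exact: y_neq0|exact: takes_x|exact: takes_y].
Qed.

(** On the line y = 1 the function is (t + x)^n, which takes the values 0 and 1. *)
Lemma nonconstant_fib_exp t n : (0 < n)%N -> nonconstant (fib t ^+ n).
Proof.
move=> n0 c e.
have E z : (t + z) ^+ n = c.
  have := takes_exp n (takes_fib t (p := (z, 1)) (oner_neq0 _)).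
  rewrite e divr1 mulr1 => tz.
  by have [] := takes_uniq tz (takes_cst c _).
have := E (1 - t); rewrite -(E (- t)) addrC subrK subrr expr1n expr0n.
by case: n n0 {e E} => // n _ /eqP; rewrite oner_eq0.
Qed.

(** The differentials are (1/y, s - x/y^2) and (1/y, - s - x/y^2); their determinant - 2 s / y is
    nonzero off the line y = 0. *)
Lemma transverse_fib : generically_transverse (fib s) (fib (- s)).
Proof.
exists 'Y => [|p]; rewrite ?polyC_eq0 ?polyX_eq0 // !hornerE => p0.
have pX t : takes (dX (fib t)) p (Some p.2^-1).
  rewrite dX_fib rmorph1 -[p.2^-1]div1r; apply: takes_div => //; first exact: y_neq0.
    by rewrite -(rmorph1 (@cst C)); exact: takes_cst.
  exact: takes_y.
have pY t : takes (dY (fib t)) p (Some (t - p.1 / p.2 ^+ 2)).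
  rewrite dY_fib -dY_fib_step //.
  have NE : (t%:P%:P * 'Y ^+ 2 - 'X).[p.1, p.2] = t * p.2 ^+ 2 - p.1.
    by rewrite !hornerE; ring.
  have DE : ('Y ^+ 2 : {poly {poly C}}).[p.1, p.2] = p.2 ^+ 2 by rewrite !hornerE.
  have := @takes_frac C (t%:P%:P * 'Y ^+ 2 - 'X) ('Y ^+ 2) p.
  rewrite NE DE /proj_div (negPf (expf_neq0 2 p0)) orbT; apply=> //.
  by rewrite expf_neq0 // polyC_eq0 polyX_eq0.
exists p.2^-1, (s - p.1 / p.2 ^+ 2), p.2^-1, (- s - p.1 / p.2 ^+ 2).
split=> //.
  by exists (s * p.2 + p.1 / p.2), (- s * p.2 + p.1 / p.2); split; exact: takes_fib.
move=> u1 u2 e1 e2; have : (s + s) * u2 = 0.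
  by rewrite -(subrr 0) -{1}e1 -e2; ring.
move/eqP; rewrite mulf_eq0 -mulr2n mulrn_eq0 (negPf s_neq0) /= => /eqP u20.
move: e1; rewrite u20 mulr0 addr0 => /eqP.
by rewrite mulf_eq0 invr_eq0 (negPf p0) /= => /eqP.
Qed.

(** The Jacobian of the powers is that of the two fibrations, - 2 s / y, times n^2 and powers of the
    fibrations, all nonzero. *)
Lemma independent_fib n : (0 < n)%N -> independent (fib s ^+ n) (fib (- s) ^+ n).
Proof.
case: n => // n _; rewrite /independent.
rewrite /dX /dY !(quotient_ruleX dpolyXM).
rewrite !(quotient_ruleX dpolyYM) jacobian_powers.
have fib0 t : fib t != 0.
  apply/eqP => e; apply: (@nonconstant_fib_exp t 1 isT 0).
  by rewrite expr1 e (rmorph0 (@cst C)).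
have n0 : n.+1%:R != 0 :> ratfun C.
  rewrite -(rmorph_nat (@cst C)) polyF_eq0 !polyC_eq0 pnatr_eq0 //.
have EX t : dX (fib t) = y^-1 by rewrite dX_fib rmorph1 div1r.
have EY t : dY (fib t) = cst t - x / y ^+ 2.
  rewrite dY_fib polyFX -(dY_fib_step (cst t) x y_neq0); congr (_ / _).
  by rewrite /cst /xF /yF polyFB polyFM polyFX.
rewrite -/(dX (fib s)) -/(dX (fib (- s))) -/(dY (fib s)) -/(dY (fib (- s))).
rewrite !EX !EY.
rewrite (rmorphN (@cst C)).
rewrite (jacobian_step (cst s) x y_neq0).
apply: mulf_neq0.
  exact: (mulf_neq0 (mulf_neq0 n0 n0)
    (mulf_neq0 (expf_neq0 n (fib0 s)) (expf_neq0 n (fib0 (- s))))).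
apply: mulf_neq0; last by rewrite invr_eq0 y_neq0.
rewrite oppr_eq0 -(rmorphD (@cst C)) polyF_eq0 !polyC_eq0 -mulr2n mulrn_eq0.
exact: s_neq0.
Qed.

Lemma preserves_fib t : t ^+ 2 = a1 -> preserves_fibration f (fib t).
Proof.
move=> t2; apply: preserves_fibration_scale (subst_fib t2) => //.
  by move: a1_neq0; rewrite -t2; apply: contra_neq => ->; rewrite expr0n.
by rewrite -[fib t]expr1; exact: nonconstant_fib_exp.
Qed.

Lemma first_integral_fib t n : t ^+ 2 = a1 -> (0 < n)%N -> a1 ^+ n = 1 ->
  first_integral f (fib t ^+ (2 * n)).
Proof.
move=> t2 n0 a1n; split; first by apply: nonconstant_fib_exp; rewrite muln_gt0.
rewrite substX; last exact: dominant_fmap.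
by rewrite subst_fib // exprMn -(rmorphXn (@cst C)) exprM t2 a1n rmorph1 mul1r.
Qed.

Lemma periodic_fmap00 n : a1 ^+ n = 1 -> periodic (2 * n) f.
Proof.
move=> a1n; have a1m : a1 ^+ (2 * n) = 1 by rewrite mulnC exprM a1n expr1n.
apply: periodic_fmap => //; first by rewrite iter_hmap0 mul0r.
rewrite !(rmorph0 (@cst C)); have [c ->] := yvec_even (cst a1) x n (y, 1).
by exists c; rewrite -(rmorphXn (@cst C)) a1n rmorph1 !mulr1.
Qed.

End TwoFibrations.

(** * Pencils of polynomials in one variable *)

Section Pencils.

Variable C : numClosedFieldType.
Implicit Types p q P Q : {poly C}.

Lemma deriv_eq0_size p : p^`() = 0 -> (size p <= 1)%N.
Proof.
move=> p0; apply/leq_sizeP => -[|j] // _.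
have /eqP := congr1 (fun r : {poly C} => r`_j) p0.
by rewrite coef_deriv coef0 mulrn_eq0 /= => /eqP.
Qed.

(** By coprimality p divides p', and the degree forces p' = 0, so p is constant in characteristic
    zero. *)
Lemma coprimep_wronskian_eq0 p q : coprimep p q -> p^`() * q = p * q^`() ->
  (size p <= 1)%N.
Proof.
move=> cpq w; apply: deriv_eq0_size; apply/eqP; apply: contraT => p0.
have pp' : p %| p^`() by rewrite -(Gauss_dvdpl _ cpq) w dvdp_mulIl.
have p1 : p != 0 by apply: contra_neq p0 => ->; rewrite derivC.
by have := dvdp_leq p0 pp'; rewrite leqNgt lt_size_deriv.
Qed.

Lemma size_lt_of_coef0 n p : (size p <= n.+1)%N -> p`_n = 0 -> (size p <= n)%N.
Proof.
move=> sp pn; apply/leq_sizeP => j; rewrite leq_eqVlt => /predU1P[<-//|nj].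
by rewrite nth_default // (leq_trans sp).
Qed.

(** In lowest terms p / q has degree d + 1, hence size d + 2; the shift keeps the degree
    positive. *)
Definition pencil d p q := coprimep p q /\ maxn (size p) (size q) = d.+2.

Lemma pencilC d p q : pencil d p q -> pencil d q p.
Proof. by move=> [cpq m]; rewrite /pencil coprimep_sym maxnC. Qed.

(** If a != 0, then q divides p; coprimality makes q, and then p, constant, against the positive
    degree. *)
Lemma pencil_free d p q (a b : C) : pencil d p q -> a *: p + b *: q = 0 ->
  a = 0 /\ b = 0.
Proof.
suff E p1 q1 (a1 b1 : C) : pencil d p1 q1 -> a1 *: p1 + b1 *: q1 = 0 -> a1 = 0.
  move=> pq e; split; first exact: E pq e.
  by apply: E (pencilC pq) _; rewrite addrC; exact: e.
move=> [cpq m] e; apply/eqP; apply: contraT => a0.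
have e1 : p1 = (- (b1 / a1)) *: q1.
  apply: (scalerI a0); rewrite scalerA mulrN mulrC divfK //.
  by rewrite scaleNr; apply/eqP; rewrite -addr_eq0 e.
have q1p1 : q1 %| p1 by rewrite e1 -mul_polyC dvdp_mulIr.
have := coprimepP _ _ cpq q1 q1p1 (dvdpp q1).
rewrite -size_poly_eq1 => /eqP s1.
have : (maxn (size p1) (size q1) <= 1)%N.
  by rewrite geq_max s1 e1 (leq_trans (size_scale_leq _ _)) // s1.
by rewrite m.
Qed.

Lemma pencil_inj d p q (a b a' b' : C) : pencil d p q ->
  a *: p + b *: q = a' *: p + b' *: q -> a = a' /\ b = b'.
Proof.
move=> pq /eqP; rewrite -subr_eq0 opprD addrACA -!scalerBl => /eqP.
by move/(pencil_free pq) => [/eqP + /eqP]; rewrite !subr_eq0 => /eqP-> /eqP->.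
Qed.

(* The level v of p / q consists of d + 1 distinct nonzero points. *)
Definition generic_level d p q (v : C) :=
  size (p - v *: q) = d.+2 /\
  forall y, root (p - v *: q) y -> y != 0 /\ (p - v *: q)^`().[y] != 0.

Lemma pencil_generic d p q : pencil d p q ->
  exists s : seq C, forall v, v \notin s -> generic_level d p q v.
Proof.
move=> pq; have [cpq m] := pq.
pose W := p^`() * q - p * q^`().
have W0 : W != 0.
  apply/eqP => /eqP; rewrite subr_eq0 => /eqP w.
  have p1 := coprimep_wronskian_eq0 cpq w.
  have q1 : (size q <= 1)%N.
    by apply: (@coprimep_wronskian_eq0 q p); rewrite 1?coprimep_sym // mulrC -w mulrC.
  by move: m; rewrite /maxn; case: ifP => _ e; [move: q1|move: p1]; rewrite e.
have [rs Wrs] := closed_field_poly_normal W.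
(* Excluded levels: those where the degree drops, where y = 0 is a root, and the values at the zeros
   of the Wronskian, which are the only possible multiple roots. *)
exists ([:: p`_d.+1 / q`_d.+1; p.[0] / q.[0]] ++ [seq p.[y] / q.[y] | y <- rs]).
move=> v; rewrite mem_cat negb_or !inE negb_or => /andP[/andP[v1 v2] v3].
have notboth y : root (p - v *: q) y -> q.[y] != 0 /\ v = p.[y] / q.[y].
  rewrite /root !hornerE subr_eq0 => /eqP py.
  have q0 : q.[y] != 0.
    apply/eqP => qy0; have := coprimep_root cpq (x := y).
    by rewrite /root py qy0 mulr0 eqxx => /(_ isT).
  by split=> //; rewrite py mulfK.
split.
  apply/eqP; rewrite eqn_leq; apply/andP; split.
    rewrite (leq_trans (size_polyD _ _)) // size_polyN geq_max -m leq_maxl /=.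
    by rewrite (leq_trans (size_scale_leq _ _)) // leq_maxr.
  rewrite ltnNge; apply/negP => /leq_sizeP/(_ d.+1 (leqnn _))/eqP.
  apply/negP; rewrite coefB coefZ.
  have [qd0|qd0] := eqVneq q`_d.+1 0; last first.
    by rewrite subr_eq0; apply: contra_neq v1 => ->; rewrite mulfK.
  rewrite qd0 mulr0 subr0; apply: contraTneq (eqxx d.+2) => pd0.
  rewrite -{1}m ltn_eqF // ltnS geq_max; apply/andP; split.
    by apply: size_lt_of_coef0 pd0; rewrite -m leq_maxl.
  by apply: size_lt_of_coef0 qd0; rewrite -m leq_maxr.
move=> y ry; have [qy vE] := notboth y ry; split.
  by apply: contra_neq v2 => y0; rewrite vE y0.
apply: contraNneq v3 => dy; rewrite vE; apply/mapP; exists y => //.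
rewrite -root_prod_XsubC -(rootZ _ _ (a := lead_coef W)) ?lead_coef_eq0 // -Wrs.
apply/rootP; rewrite /W; move: dy; rewrite derivB derivZ !hornerE => /eqP.
by rewrite subr_eq0 => /eqP->; rewrite vE; field.
Qed.

Lemma simple_roots_dvdp P Q : P != 0 ->
  (forall y, root P y -> P^`().[y] != 0) ->
  (forall y, root P y -> root Q y) -> P %| Q.
Proof.
move=> P0 simple PQ; have [rs Prs] := closed_field_poly_normal P.
have lP : lead_coef P != 0 by rewrite lead_coef_eq0.
have rPE y : root P y = (y \in rs) by rewrite Prs rootZ // root_prod_XsubC.
have : separable_poly P by rewrite unlock; apply: Pdiv.ClosedField.root_coprimep.
rewrite Prs (eqp_separable (eqp_scale _ lP)) separable_prod_XsubC => urs.
rewrite dvdpZl //; apply: uniq_roots_dvdp; last by rewrite uniq_rootsE.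
by apply/allP => y yrs; apply: PQ; rewrite rPE.
Qed.

Lemma levelE (k v : C) p q :
  k *: (p - v *: q) = k *: p + - (k * v) *: q.
Proof. by rewrite scalerBr scalerA scaleNr. Qed.

(** The level has d + 1 simple roots, all roots of Q, and Q has degree at most d + 1. *)
Lemma generic_level_colinear d p q v Q : generic_level d p q v ->
  (size Q <= d.+2)%N ->
  (forall y, y != 0 -> root (p - v *: q) y -> root Q y) ->
  exists k, Q = k *: (p - v *: q).
Proof.
move=> [sP gP] sQ rQ; set P := p - v *: q in sP gP rQ *.
have P0 : P != 0 by rewrite -size_poly_eq0 sP.
have /dvdpP[u uE] : P %| Q.
  apply: simple_roots_dvdp => // y ry; have [y0 ?] := gP y ry => //.
  exact: rQ.
have [u0|u0] := eqVneq u 0; first by exists 0; rewrite uE u0 mul0r scale0r.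
have : (size u <= 1)%N.
  by move: sQ; rewrite uE size_mul // sP addnS /= -[d.+2]add1n leq_add2r.
by move/size1_polyC => uC; exists u`_0; rewrite uE {1}uC mul_polyC.
Qed.

(** The relation w = (a v + b) / (c v + e), cleared of denominators. *)
Definition moebius_at (a b c e : C) (v : C) (w : option C) :=
  if w is Some w then w * (c * v + e) = a * v + b else c * v + e = 0.

(** Here [K v w] says that level v of p / q lies in level w of P / Q, away from y = 0. For generic v
    this makes P - w Q, or Q when w is infinite, a multiple of p - v q; two finite levels then
    express P and Q through p and q. *)
Lemma pencil_moebius d p q P Q (K : C -> option C -> Prop) :
  pencil d p q -> (size P <= d.+2)%N -> (size Q <= d.+2)%N ->
  (forall a b, a *: P + b *: Q = 0 -> a = 0 /\ b = 0) ->
  (forall v, exists w, K v w) ->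
  (forall v w y, K v w -> y != 0 -> root (p - v *: q) y ->
     if w is Some w then P.[y] = w * Q.[y] else Q.[y] = 0) ->
  exists a b c e, [/\ a * e - b * c != 0, P = a *: p + b *: q,
    Q = c *: p + e *: q &
    exists s : seq C, forall v w, v \notin s -> K v w -> moebius_at a b c e v w].
Proof.
move=> pq sP sQ free totK HK; have [s gs] := pencil_generic pq.
have pfree := pencil_free pq.
have Kfin v w : v \notin s -> K v (Some w) ->
    exists k, P - w *: Q = k *: (p - v *: q).
  move=> /gs gv Kvw; apply: generic_level_colinear gv _ _.
    rewrite (leq_trans (size_polyD _ _)) // size_polyN geq_max sP /=.
    by rewrite (leq_trans (size_scale_leq _ _)).
  by move=> y y0 ry; have /= e := HK _ _ _ Kvw y0 ry; rewrite /root !hornerE e subrr.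
have Kinf v : v \notin s -> K v None -> exists k, Q = k *: (p - v *: q).
  move=> /gs gv Kvw; apply: generic_level_colinear gv sQ _.
  by move=> y y0 ry; have /= e := HK _ _ _ Kvw y0 ry; rewrite /root e.
have Kinf_uniq v v' : v \notin s -> v' \notin s -> K v None -> K v' None -> v = v'.
  move=> vs vs' /Kinf[] // k e /Kinf[] // k' e'.
  have k0 : k != 0.
    apply/eqP => k0; have [] := free 0 1; last by move=> _ /eqP; rewrite oner_eq0.
    by rewrite e k0 !scale0r scaler0 addr0.
  move: e'; rewrite {1}e !levelE => /(pencil_inj pq)[<-].
  by move/eqP; rewrite eqr_opp => /eqP/(mulfI k0).
(* At most one generic level goes to infinity, so among three of them two go to finite levels. *)
have [v1 [v2 [w1 [w2 [v1s v2s v12 K1 K2]]]]] : exists v1 v2 w1 w2,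
    [/\ v1 \notin s, v2 \notin s, v1 != v2, K v1 (Some w1) & K v2 (Some w2)].
  have [u1 u1s] := exists_notin s.
  have [u2] := exists_notin (u1 :: s); rewrite inE negb_or => /andP[u21 u2s].
  have [u3] := exists_notin (u1 :: u2 :: s).
  rewrite !inE !negb_or => /and3P[u31 u32 u3s].
  have [[x1|] k1] := totK u1; have [[x2|] k2] := totK u2.
  - by exists u1, u2, x1, x2; rewrite eq_sym.
  - have [[x3|] k3] := totK u3; first by exists u1, u3, x1, x3; rewrite eq_sym.
    by rewrite (Kinf_uniq _ _ u3s u2s k3 k2) eqxx in u32.
  - have [[x3|] k3] := totK u3; first by exists u2, u3, x2, x3; rewrite eq_sym.
    by rewrite (Kinf_uniq _ _ u3s u1s k3 k1) eqxx in u31.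
  - by rewrite (Kinf_uniq _ _ u2s u1s k2 k1) eqxx in u21.
have [k1 e1] := Kfin _ _ v1s K1; have [k2 e2] := Kfin _ _ v2s K2.
rewrite !levelE in e1 e2.
have w12 : w2 - w1 != 0.
  rewrite subr_eq0; apply: contra_neq v12 => w12.
  have [<- /eqP] : k1 = k2 /\ - (k1 * v1) = - (k2 * v2).
    by apply: (pencil_inj pq); rewrite -e1 -e2 w12.
  rewrite eqr_opp => /eqP; apply: mulfI; apply/eqP => k10.
  have [] := free 1 (- w1); last by move/eqP; rewrite oner_eq0.
  by rewrite scale1r scaleNr e1 k10 mul0r oppr0 !scale0r addr0.
(* Solution of (w2 - w1) Q = k1 (p - v1 q) - k2 (p - v2 q). *)
set c := (k1 - k2) / (w2 - w1); set e := (k2 * v2 - k1 * v1) / (w2 - w1).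
have QE : Q = c *: p + e *: q.
  apply: (scalerI w12); rewrite scalerDr !scalerA /c /e.
  rewrite ![(w2 - w1) * _]mulrC !divfK // !scalerBl.
  have -> : w2 *: Q = P - (k2 *: p + - (k2 * v2) *: q) by rewrite -e2 subKr.
  have -> : w1 *: Q = P - (k1 *: p + - (k1 * v1) *: q) by rewrite -e1 subKr.
  rewrite -!mul_polyC !rmorphN /=; ring.
have PE : P = (w1 * c + k1) *: p + (w1 * e - k1 * v1) *: q.
  rewrite -[LHS](subrK (w1 *: Q)) e1 {1}QE scalerDr !scalerA.
  by rewrite !scalerDl addrC addrACA.
exists (w1 * c + k1), (w1 * e - k1 * v1), c, e; split=> //.
  move: PE QE; set a := w1 * c + k1; set b := w1 * e - k1 * v1 => PE QE.
  (* If the determinant vanished, c P - a Q = 0 would give a = c = 0, then e P - b Q = 0 would give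
     e = 0, and Q = 0 would contradict independence. *)
  apply/eqP => det0.
  have [] := free c (- a).
    rewrite {1}PE QE !scalerDr !scalerA addrACA -!scalerDl.
    have -> : c * b + - a * e = - (a * e - b * c) by ring.
    by rewrite det0 mulrC mulNr subrr oppr0 !scale0r addr0.
  move=> c0 /eqP; rewrite oppr_eq0 => /eqP a0.
  have [] := free e (- b).
    rewrite PE QE c0 a0 !scale0r !add0r !scalerA -scalerDl.
    by rewrite mulrC mulNr subrr scale0r.
  move=> e0 _; have [] := free 0 1; last by move=> _ /eqP; rewrite oner_eq0.
  by rewrite QE c0 e0 !scale0r addr0 scaler0 addr0.
move: PE QE; set a := w1 * c + k1; set b := w1 * e - k1 * v1 => PE QE.
exists s => v [w|] vs Kvw /=.
  have [k] := Kfin _ _ vs Kvw; rewrite levelE {1}PE QE.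
  rewrite scalerDr opprD addrACA !scalerA -!scalerBl => /(pencil_inj pq)[ka kb].
  have -> : b = - (k * v) + w * e by rewrite -kb; ring.
  by rewrite -ka; ring.
have [k] := Kinf _ vs Kvw; rewrite levelE QE => /(pencil_inj pq)[-> ->].
by rewrite subrr.
Qed.

(** The cross-multiplied difference of the two Moebius maps is a quadratic in v with cofinitely many
    zeros; its three coefficients vanish. *)
Lemma moebius_unique a b c e a' b' c' e' (K : C -> option C -> Prop) (s s' : seq C) :
  (forall v, exists w, K v w) ->
  (forall v w, v \notin s -> K v w -> moebius_at a b c e v w) ->
  (forall v w, v \notin s' -> K v w -> moebius_at a' b' c' e' v w) ->
  [/\ a * c' = a' * c, a * e' + b * c' = a' * e + b' * c & b * e' = b' * e].
Proof.
move=> totK M M'.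
pose F := (a *: 'X + b%:P) * (c' *: 'X + e'%:P) - (a' *: 'X + b'%:P) * (c *: 'X + e%:P).
have F0 : F = 0.
  apply: (@poly_cofinite_eq0 _ (s ++ s')) => v; rewrite mem_cat negb_or.
  move=> /andP[vs vs']; have [w Kvw] := totK v.
  have := M _ _ vs Kvw; have := M' _ _ vs' Kvw; rewrite /F !hornerE /moebius_at.
  case: w {Kvw} => [w|] e1 e2; last by rewrite e1 e2 !mulr0 subrr.
  by rewrite -e1 -e2; ring.
have FE : F = (a * c' - a' * c)%:P * 'X^2 +
    (a * e' + b * c' - (a' * e + b' * c))%:P * 'X + (b * e' - b' * e)%:P.
  by rewrite /F -!mul_polyC; ring.
have coefF i := congr1 (fun r : {poly C} => r`_i) (etrans (esym FE) F0).
have := (coefF 2, coefF 1, coefF 0)%N; rewrite !coefE /= !(mulr0, mulr1, addr0, add0r).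
by case=> -[/subr0_eq-> /subr0_eq->] /subr0_eq->.
Qed.

(** Clear denominators at y = s / t. Relative to the lowest nonzero coefficient, of index j, all
    other terms are divisible by s^(j+1), so s divides that coefficient times a power of t, hence
    the coefficient. *)
Lemma rational_root_dvdp (E : {poly {poly C}}) (s t : {poly C}) (bad : seq C) :
  E != 0 -> s != 0 -> t != 0 -> coprimep s t ->
  (forall c, c \notin bad ->
    (map_poly (horner_eval c) E).[s.[c] / t.[c]] = 0) ->
  exists2 j, E`_j != 0 & s %| E`_j.
Proof.
move=> E0 s0 t0 cst rootE; set m := size E.
pose F := \sum_(j < m) E`_j * s ^+ j * t ^+ (m - j).
have F0 : F = 0.
  have [rs trs] := closed_field_poly_normal t.
  apply: (@poly_cofinite_eq0 _ (bad ++ rs)) => c; rewrite mem_cat negb_or.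
  move=> /andP[cb crs]; have tc : t.[c] != 0.
    rewrite -[_ == 0]/(root t c) trs rootZ ?root_prod_XsubC //.
    by rewrite lead_coef_eq0.
  have <- : t.[c] ^+ m * (map_poly (horner_eval c) E).[s.[c] / t.[c]] = F.[c].
    rewrite (horner_coef_wide _ (size_poly _ _)) mulr_sumr horner_sum.
    apply: eq_bigr => j _; rewrite coef_map /= /horner_eval !hornerM !horner_exp.
    have -> : t.[c] ^+ m = t.[c] ^+ j * t.[c] ^+ (m - j).
      by rewrite -exprD subnKC // ltnW.
    rewrite expr_div_n.
    by field; rewrite expf_neq0.
  by rewrite rootE // mulr0.
have exE : exists j, E`_j != 0.
  by exists m.-1; rewrite -lead_coefE lead_coef_eq0.
have [j Ej minj] := ex_minnP exE; exists j => //.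
have jm : (j < m)%N by rewrite ltnNge; apply: contra Ej => mj; rewrite nth_default.
rewrite -(Gauss_dvdpl _ (coprimep_expr (m - j) cst)).
rewrite -(dvdp_mul2l _ _ (expf_neq0 j s0)) -exprSr.
move: F0; rewrite /F (bigD1 (Ordinal jm)) //= => /eqP; rewrite addr_eq0 => /eqP e.
rewrite mulrA [s ^+ j * E`_j]mulrC e dvdpNr.
apply: (big_ind (fun r => s ^+ j.+1 %| r)); rewrite ?dvdp0 //.
  by move=> u v; apply: dvdp_add.
move=> i; rewrite -val_eqE /= => ij; have [ilj|jli] := ltnP i j.
  have -> : E`_i = 0 by apply/eqP; apply: contraTT ilj => /minj; rewrite -leqNgt.
  by rewrite !mul0r dvdp0.
by rewrite dvdp_mulr // dvdp_mull // dvdp_exp2l // ltn_neqAle eq_sym ij.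
Qed.

End Pencils.

(** * Preserved fibrations, fibre by fibre *)

Section Fibres.

Variable C : numClosedFieldType.
Implicit Types (N D : {poly {poly C}}).

Lemma poly_nonroots (p : {poly C}) :
  exists s : seq C, forall x, x \notin s -> p != 0 -> p.[x] != 0.
Proof.
have [rs prs] := closed_field_poly_normal p; exists rs => x xrs p0.
by rewrite -[_ == 0]/(root p x) prs rootZ ?root_prod_XsubC // lead_coef_eq0.
Qed.

(** Coprimality is in y over C[x]: a common factor in x alone may remain. The scalars k and l come
    from pseudo-division by the gcd. *)
Lemma ratfun_coprime (V : ratfun C) : exists N D,
  [/\ D != 0, V = polyF N / polyF D & coprimep (swapXY N) (swapXY D)].
Proof.
have [N [D [D0 VE]]] := ratfunP V.
set A := swapXY N; set B := swapXY D; set g := gcdp A B.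
have B0 : B != 0 by rewrite swapXY_eq0.
have g0 : g != 0 by rewrite gcdp_eq0 negb_and B0 orbT.
have [[k u] /= k0 e1] := Pdiv.Idomain.dvdpP _ _ (dvdp_gcdl A B).
have [[l v] /= l0 e2] := Pdiv.Idomain.dvdpP _ _ (dvdp_gcdr A B).
have v0 : v != 0.
  apply: contra_neq l0 => v0; move/eqP: e2.
  rewrite v0 mul0r -mul_polyC mulf_eq0 polyC_eq0.
  by rewrite (negPf B0) orbF => /eqP.
have D0' : swapXY (k *: v) != 0 by rewrite swapXY_eq0 -mul_polyC mulf_neq0 // polyC_eq0.
exists (swapXY (l *: u)), (swapXY (k *: v)); split=> //.
  rewrite VE; apply/eqP; rewrite eqr_div ?polyF_eq0 // -!polyFM.
  apply/eqP; congr polyF; apply: (can_inj (@swapXYK C)).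
  rewrite !rmorphM /= !swapXYK -/A -/B; apply: (mulIf g0).
  rewrite -!mul_polyC -/g in e1 e2 *; transitivity (k%:P * A * (v * g)); first by ring.
  by rewrite e1 -e2; ring.
rewrite !swapXYK coprimepZl // coprimepZr // coprimep_def.
have : gcdp (u * g) (v * g) %= 1 * g.
  rewrite mul1r -e1 -e2 (eqp_trans (eqp_gcdl _ (eqp_scale _ k0))) //.
  exact: eqp_gcdr (eqp_scale _ l0).
rewrite (eqp_ltrans (gcdp_mul2r _ _ _)) eqp_mul2r // => /eqp_size->.
by rewrite size_poly1.
Qed.

(** A Bezout relation u A + v B = r(x) specializes wherever r(x) != 0, and the degrees in y persist
    where the leading coefficients do not vanish. *)
Lemma good_fibre N D d : coprimep (swapXY N) (swapXY D) ->
  maxn (size (swapXY N)) (size (swapXY D)) = d.+2 ->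
  exists s : seq C, forall x, x \notin s -> pencil d N.[x%:P] D.[x%:P].
Proof.
set A := swapXY N; set B := swapXY D => cAB m.
have [[u v] /= uv] := Bezout_coprimepP _ _ cAB.
have [r r0 rE] : exists2 r : {poly C}, r != 0 & u * A + v * B = r%:P.
  move: uv; rewrite -size_poly_eq1 => /size_poly1P[r r0 ->]; by exists r.
have [s1 Hs1] := poly_nonroots r.
have [s2 Hs2] := poly_nonroots (lead_coef A).
have [s3 Hs3] := poly_nonroots (lead_coef B).
exists (s1 ++ s2 ++ s3) => x; rewrite !mem_cat !negb_or => /and3P[x1 x2 x3].
rewrite /pencil !horner_polyC -/A -/B; split.
  apply/Bezout_coprimepP; exists (map_poly (horner_eval x) u, map_poly (horner_eval x) v).
  have := congr1 (map_poly (horner_eval x)) rE.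
  rewrite rmorphD !rmorphM /= map_polyC => -> /=.
  by rewrite -size_poly_eq1 size_polyC /horner_eval Hs1.
have sz (E : {poly {poly C}}) (s : seq C) : (forall x, x \notin s -> lead_coef E != 0 ->
    (lead_coef E).[x] != 0) -> x \notin s -> size (map_poly (horner_eval x) E) = size E.
  move=> Hs xs; have [->|E0] := eqVneq E 0; first by rewrite map_poly0 !size_poly0.
  by apply: size_map_poly_id0; apply: Hs => //; rewrite lead_coef_eq0.
by rewrite (sz _ _ Hs2 x2) (sz _ _ Hs3 x3).
Qed.

Lemma pencil_nonzero d (p q : {poly C}) y : pencil d p q ->
  (p.[y] != 0) || (q.[y] != 0).
Proof.
move=> [cpq _]; have [py|//] := eqVneq p.[y] 0.
by apply: coprimep_root cpq _; apply/rootP.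
Qed.

(* The polynomial y ^ d * u (b + x / y), when u has degree at most d. *)
Definition homogenized d (b x : C) (u : {poly C}) : {poly C} :=
  \sum_(i < d.+1) u`_i *: ((b *: 'X + x%:P) ^+ i * 'X ^+ (d - i)).

Lemma size_homogenized d b x u : (size (homogenized d b x u) <= d.+1)%N.
Proof.
rewrite (leq_trans (size_sum _ _ _)) //; apply/bigmax_leqP => i _.
rewrite (leq_trans (size_scale_leq _ _)) // (leq_trans (size_polyMleq _ _)) //.
rewrite size_polyXn addnS /=.
have s2 : (size (b *: 'X + x%:P)%R <= 2)%N.
  rewrite (leq_trans (size_polyD _ _)) // geq_max size_polyC.
  rewrite (leq_trans (size_scale_leq _ _)) ?size_polyX //=.
  by case: (x != 0).
have s3 : (size ((b *: 'X + x%:P) ^+ i)%R <= i.+1)%N.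
  rewrite (leq_trans (size_poly_exp_leq _ _)) // ltnS -[X in (_ <= X)%N]mul1n.
  by rewrite leq_mul2r; move: s2; case: (size _) => [|[|[|]]]; rewrite ?orbT.
by rewrite (leq_trans (leq_add s3 (leqnn _))) // addSn subnKC // -ltnS.
Qed.

Lemma horner_homogenized d b x (u : {poly C}) (y : C) : y != 0 -> (size u <= d.+1)%N ->
  (homogenized d b x u).[y] = y ^+ d * u.[b + x / y].
Proof.
move=> y0 su; rewrite (horner_coef_wide _ su) mulr_sumr horner_sum.
apply: eq_bigr => i _; rewrite hornerZ hornerM !horner_exp.
rewrite hornerD hornerZ hornerX hornerC.
have -> : y ^+ d = y ^+ i * y ^+ (d - i).
  by rewrite -exprD subnKC // -ltnS.
have -> : b * y + x = y * (b + x / y) by field.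
by rewrite exprMn; ring.
Qed.

Lemma homogenized_linear d b x u v (k l : C) :
  k *: homogenized d b x u + l *: homogenized d b x v =
  homogenized d b x (k *: u + l *: v).
Proof.
rewrite !scaler_sumr -big_split; apply: eq_bigr => i _ /=.
by rewrite !scalerA -scalerDl coefD !coefZ.
Qed.

(** For x != 0 the map y |-> b + x / y reaches every z != b from some y != 0. *)
Lemma homogenized_eq0 d b x (u : {poly C}) : x != 0 -> (size u <= d.+1)%N ->
  homogenized d b x u = 0 -> u = 0.
Proof.
move=> x0 su h0; apply: (@poly_cofinite_eq0 _ [:: b]) => z.
rewrite inE -subr_eq0 => zb; have y0 : x / (z - b) != 0.
  by rewrite mulf_neq0 ?invr_eq0.
have /eqP := horner_homogenized b x y0 su.
rewrite h0 horner0 eq_sym mulf_eq0 expf_eq0 (negPf y0) andbF /= => /eqP.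
by rewrite invf_div mulrC divfK // addrC subrK.
Qed.

End Fibres.

(** * Transport of levels along orbits *)

Section Uniqueness.

Variables (C : numClosedFieldType) (a0 a1 b : C).
Hypothesis a1_neq0 : a1 != 0.

Local Notation h := (hmap a0 a1).
Local Notation hP := (hmap a0%:P a1%:P).
Local Notation vecP := (yvec a0%:P a1%:P b%:P).
Local Notation f := (fmap a0 a1 b).

(** A matrix is singular only where the orbit of c meets 0. At the first such time j the vector must
    avoid the kernel (0, 1), which excludes one y for each j < n; it then becomes a nonzero multiple
    of (b, 1) over a0, whose orbit never vanishes by hypothesis. *)
Lemma exists_section : (forall k, ~ reaches_origin a0 a1 b k) ->
  forall n, exists y, forall c, yvec a0 a1 b n c (y, 1) <> (0, 0).
Proof.
move=> nr n; pose u j w := (yvec a0 a1 b j (iter j (hinv a0 a1) 0) w).1.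
have [y ys] := exists_notin [seq - u j (0, 1) / u j (1, 0) | j <- iota 0 n].
exists y => c; case: (boolP (has (fun j => iter j h c == 0) (iota 0 n))); last first.
  move=> /hasPn hc; rewrite yvec_linear /= !mul1r => -[e1 e2].
  have : \prod_(j < n) - iter j h c == 0.
    rewrite -(yvec_det a0 a1 b n c).
    have -> : (yvec a0 a1 b n c (0, 1)).1 = - (y * (yvec a0 a1 b n c (1, 0)).1).
      by apply/eqP; rewrite -addr_eq0 addrC e1.
    have -> : (yvec a0 a1 b n c (0, 1)).2 = - (y * (yvec a0 a1 b n c (1, 0)).2).
      by apply/eqP; rewrite -addr_eq0 addrC e2.
    by apply/eqP; ring.
  rewrite prodf_seq_eq0 => /hasP[j _ /=]; rewrite oppr_eq0.
  by apply/negP/hc; rewrite mem_iota /=.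
move=> /hasP hc.
have exj : exists j, (j < n)%N && (iter j h c == 0).
  by case: hc => j; rewrite mem_iota => jn jc; exists j; apply/andP.
have [j /andP[jn /eqP jc] minj] := ex_minnP exj.
have cE : c = iter j (hinv a0 a1) 0 by rewrite -jc iter_hmapK.
rewrite -(subnK jn) yvec_add /= jc /ystep mul0r addr0.
have -> : h 0 = a0 by rewrite /hmap mulr0 addr0.
set w := (yvec a0 a1 b j c (y, 1)).1.
have := yvec_scale a0 a1 b (n - j.+1) a0 w (b, 1); rewrite /= mulr1 mulrC => ->.
have w0 : w != 0.
  rewrite /w yvec_linear /= mul1r cE -/(u j (1, 0)) -/(u j (0, 1)).
  (* If this coefficient is zero, the other is not, because the first j matrices are invertible; no
     value of y has to be excluded. *)
  have [uj0|uj0] := eqVneq (u j (1, 0)) 0.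
    rewrite uj0 mulr0 add0r; apply/eqP => uj1.
    have : \prod_(i < j) - iter i h c == 0.
      rewrite -(yvec_det a0 a1 b j c) cE -/(u j (1, 0)) -/(u j (0, 1)).
      by rewrite uj0 uj1 !mul0r subrr.
    rewrite prodf_seq_eq0 => /hasP[i _ /=]; rewrite oppr_eq0 => ic.
    have := minj i; rewrite ic (ltn_trans (ltn_ord i) jn) => /(_ isT).
    by rewrite leqNgt ltn_ord.
  apply: contra ys; rewrite addr_eq0 => /eqP e; apply/mapP; exists j.
    by rewrite mem_iota.
  by rewrite -e mulfK.
case=> /eqP + /eqP; rewrite !mulf_eq0 (negPf w0) /= => /eqP e1 /eqP e2.
apply: (yvec_orbit_neq0 nr (k := n - j.+1)).
by rewrite [LHS]surjective_pairing e1 e2.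
Qed.

(** Each good fibre yields a Moebius map compatible with the relation [K] between levels of V. As
    [K] does not depend on x, all these maps agree up to scalars with the one from a reference fibre
    x1. *)
Lemma fibration_moebius N D d : D != 0 ->
  coprimep (swapXY N) (swapXY D) ->
  maxn (size (swapXY N)) (size (swapXY D)) = d.+2 ->
  preserves_fibration f (polyF N / polyF D) ->
  exists (s : seq C) (a1 a2 a3 a4 : C), a1 * a4 - a2 * a3 != 0 /\
  forall x, x \notin s -> pencil d N.[x%:P] D.[x%:P] /\
  forall y, y != 0 ->
    N.[h x, b + x / y] * (a3 * N.[x, y] + a4 * D.[x, y]) =
    D.[h x, b + x / y] * (a1 * N.[x, y] + a2 * D.[x, y]).
Proof.
move=> D0 cND m [_ pres]; have [s good] := good_fibre cND m.
set V := polyF N / polyF D in pres.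
pose K v w := forall p q, takes V p (Some v) -> maps_to f p q ->
  forall w', takes V q w' -> w' = w.
have totK v : exists w, K v w by have [w Hw] := pres (Some v); exists w.
pose s0 := 0 :: s ++ map (hinv a0 a1) s.
have fibre x : x \notin s0 -> [/\ x != 0, pencil d N.[x%:P] D.[x%:P] &
  pencil d N.[(h x)%:P] D.[(h x)%:P]].
  rewrite inE mem_cat !negb_or => /and3P[x0 xs hxs]; split=> //; first exact: good.
  apply: good; apply: contra hxs => hxs; apply/mapP; exists (h x) => //.
  by rewrite hmapK.
have step x : x \notin s0 -> exists a b' c e : C, [/\ a * e - b' * c != 0,
    homogenized d.+1 b x N.[(h x)%:P] = a *: N.[x%:P] + b' *: D.[x%:P],
    homogenized d.+1 b x D.[(h x)%:P] = c *: N.[x%:P] + e *: D.[x%:P] &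
    exists t : seq C, forall v w, v \notin t -> K v w -> moebius_at a b' c e v w].
  move=> /fibre[x0 g1 g2]; have [_ m2] := g2.
  have sN : (size N.[(h x)%:P] <= d.+2)%N by rewrite -m2 leq_maxl.
  have sD : (size D.[(h x)%:P] <= d.+2)%N by rewrite -m2 leq_maxr.
  apply: (pencil_moebius g1 _ _ _ totK); try exact: size_homogenized.
    move=> k l; rewrite homogenized_linear => /(homogenized_eq0 x0) e.
    apply: (pencil_free g2); apply: e.
    rewrite (leq_trans (size_polyD _ _)) // geq_max.
    by rewrite !(leq_trans (size_scale_leq _ _)).
  move=> v w y Kvw y0; rewrite /root !hornerE subr_eq0 => /eqP py.
  have qy : D.[x%:P].[y] != 0.
    have := pencil_nonzero y g1; rewrite py.
    by have [->|] := eqVneq D.[x%:P].[y] 0; rewrite ?mulr0 ?eqxx.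
  have tp : takes V (x, y) (Some v).
    have := @takes_frac _ N D (x, y) D0 (pencil_nonzero y g1).
    by rewrite /proj_div /= (negPf qy) py mulfK.
  have tq := @takes_frac _ N D (h x, b + x / y) D0 (pencil_nonzero _ g2).
  have <- := Kvw _ _ tp (maps_to_fmap a0 a1 b x y0) _ tq.
  rewrite !horner_homogenized // /proj_div /=.
  case: eqVneq => [->|Dz]; first by rewrite mulr0.
  by rewrite mulrCA; congr (_ * _); rewrite divfK.
have [x1 x1s] := exists_notin s0.
have [c1 [c2 [c3 [c4 [det _ _ [t1 M1]]]]]] := step x1 x1s.
exists s0, c1, c2, c3, c4; split=> // x xs; have [x0 g1 g2] := fibre x xs.
split=> // y y0; have [e1 [e2 [e3 [e4 [_ NE DE [t M]]]]]] := step x xs.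
have [E1 E2 E3] := moebius_unique totK M1 M; have [_ m2] := g2.
have sN : (size N.[(h x)%:P] <= d.+2)%N by rewrite -m2 leq_maxl.
have sD : (size D.[(h x)%:P] <= d.+2)%N by rewrite -m2 leq_maxr.
apply: (mulfI (expf_neq0 d.+1 y0)); rewrite !mulrA.
rewrite -(horner_homogenized b x y0 sN) -(horner_homogenized b x y0 sD) NE DE.
rewrite !hornerE.
set p := N.[x, y]; set q := D.[x, y].
apply/eqP; rewrite -subr_eq0; apply/eqP.
transitivity ((e1 * c3 - c1 * e3) * p ^+ 2 +
  (e1 * c4 + e2 * c3 - (c1 * e4 + c2 * e3)) * (p * q) +
  (e2 * c4 - c2 * e4) * q ^+ 2).
  by ring.
by rewrite E1 E2 E3 !subrr !mul0r !addr0.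
Qed.

Lemma horner_section k y c : yvec a0 a1 b k c (y, 1) =
  ((vecP k 'X (y%:P, 1)).1.[c], (vecP k 'X (y%:P, 1)).2.[c]).
Proof. by have := horner_yvec a0 a1 b k (y%:P, 1) c; rewrite /= !hornerC. Qed.

(** For odd k the exact degree is known. For even k, a zero first component becomes the second one
    at k + 1, where the first is nonconstant and has a root c; the whole vector would vanish
    there. *)
Lemma section_neq0 n y : (forall c, yvec a0 a1 b n c (y, 1) <> (0, 0)) ->
  forall k, (k < n)%N -> (vecP k 'X (y%:P, 1)).1 != 0.
Proof.
move=> nz k kn; apply/eqP => uk0; have kE := odd_double_half k.
case: (odd k) kE => kE.
  have := size_yvec_odd a0 b a1_neq0 k./2 y.
  by rewrite -add1n -[X in vecP X]/(true + _)%N kE uk0 size_poly0.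
have : size (vecP k.+1 'X (y%:P, 1)).1 != 1%N.
  by rewrite -kE add0n size_yvec_odd.
move/closed_rootP => [c /rootP rc]; apply: (nz c).
have e : yvec a0 a1 b k.+1 c (y, 1) = (0, 0).
  rewrite horner_section rc -[(vecP k.+1 _ _).2]/((vecP k 'X (y%:P, 1)).1).
  by rewrite uk0 horner0.
by rewrite -(subnK kn) yvec_add e yvec0.
Qed.

(** Iterating the Moebius relation along the line of height y: the level of f^k(x, y) is a Moebius
    function of the level of (x, y), with coefficients independent of x. *)
Lemma orbit_chain N D d (s : seq C) (m1 m2 m3 m4 : C) y n :
  m1 * m4 - m2 * m3 != 0 ->
  (forall x, x \notin s -> pencil d N.[x%:P] D.[x%:P] /\
    forall z, z != 0 ->
      N.[h x, b + x / z] * (m3 * N.[x, z] + m4 * D.[x, z]) =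
      D.[h x, b + x / z] * (m1 * N.[x, z] + m2 * D.[x, z])) ->
  (forall k, (k < n)%N -> (vecP k 'X (y%:P, 1)).1 != 0) ->
  forall k, (k <= n)%N -> exists (t : seq C) (l1 l2 l3 l4 : C),
    forall x, x \notin t -> let w := yvec a0 a1 b k x (y, 1) in
    [/\ w.2 != 0,
      N.[iter k h x, w.1 / w.2] * (l3 * N.[x, y] + l4 * D.[x, y]) =
      D.[iter k h x, w.1 / w.2] * (l1 * N.[x, y] + l2 * D.[x, y]) &
      (l1 * N.[x, y] + l2 * D.[x, y] != 0) || (l3 * N.[x, y] + l4 * D.[x, y] != 0)].
Proof.
move=> det Hs nz; elim=> [|k IH] kn.
  exists s, 1, 0, 0, 1 => x xs /=; rewrite oner_neq0 divr1 !mul0r !mul1r addr0 add0r.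
  by split=> //; [exact: mulrC|have [g _] := Hs x xs; exact: pencil_nonzero y g].
have [t [l1 [l2 [l3 [l4 Ht]]]]] := IH (ltnW kn).
have [r Hr] := poly_nonroots (vecP k 'X (y%:P, 1)).1.
exists (t ++ r ++ map (iter k (hinv a0 a1)) s).
exists (m1 * l1 + m2 * l3), (m1 * l2 + m2 * l4), (m3 * l1 + m4 * l3), (m3 * l2 + m4 * l4).
move=> x; rewrite !mem_cat !negb_or => /and3P[xt xr xs] /=.
have [w2 e nzA] := Ht x xt.
have w1 : (yvec a0 a1 b k x (y, 1)).1 != 0.
  by rewrite horner_section; apply: Hr => //; exact: nz.
have {}xs : iter k h x \notin s.
  apply: contra xs => xs; apply/mapP; exists (iter k h x) => //.
  by rewrite iter_hmapK.
have [g Hg] := Hs _ xs.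
set w := yvec a0 a1 b k x (y, 1) in w1 w2 e *; set X := iter k h x in g Hg e *.
have z0 : w.1 / w.2 != 0 by rewrite mulf_neq0 ?invr_eq0.
have := Hg _ z0; have -> : b + X / (w.1 / w.2) = (b * w.1 + X * w.2) / w.1.
  by field; rewrite w1 w2.
set N1 := N.[h X, _]; set D1 := D.[h X, _].
move: e (pencil_nonzero (w.1 / w.2) g).
set Nk := N.[X, _]; set Dk := D.[X, _].
set A := l1 * _ + _ in nzA *; set B := l3 * _ + _ in nzA *.
move=> e nzk E.
(* The vector (Nk, Dk) is nonzero and proportional to (A, B). *)
have [mu [AE BE]] : exists mu, A = mu * Nk /\ B = mu * Dk.
  have [Dk0|Dk0] := eqVneq Dk 0.
    have Nk0 : Nk != 0 by move: nzk; rewrite Dk0 eqxx orbF.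
    exists (A / Nk); rewrite divfK // Dk0 mulr0; split=> //.
    by apply: (mulfI Nk0); rewrite e Dk0 mul0r mulr0.
  exists (B / Dk); rewrite divfK //; split=> //.
  by apply: (mulfI Dk0); rewrite -e; field.
have EA : (m1 * l1 + m2 * l3) * N.[x, y] + (m1 * l2 + m2 * l4) * D.[x, y] =
  m1 * A + m2 * B by rewrite /A /B; ring.
have EB : (m3 * l1 + m4 * l3) * N.[x, y] + (m3 * l2 + m4 * l4) * D.[x, y] =
  m3 * A + m4 * B by rewrite /A /B; ring.
rewrite EA EB; split=> //.
  transitivity (mu * (N1 * (m3 * Nk + m4 * Dk))); first by rewrite AE BE; ring.
  by rewrite E AE BE; ring.
move: nzA; rewrite -!negb_and; apply: contra => /andP[/eqP eA /eqP eB].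
have -> : A = 0.
  apply: (mulfI det); rewrite mulr0.
  by transitivity (m4 * (m1 * A + m2 * B) - m2 * (m3 * A + m4 * B));
    [ring|rewrite eA eB !mulr0 subrr].
have -> : B = 0.
  apply: (mulfI det); rewrite mulr0.
  by transitivity (m1 * (m3 * A + m4 * B) - m3 * (m1 * A + m2 * B));
    [ring|rewrite eA eB !mulr0 subrr].
by rewrite eqxx.
Qed.

End Uniqueness.

(** * Uniqueness of the invariant fibration *)

Section Uniqueness.

Variables (C : numClosedFieldType) (a0 a1 b : C).
Hypothesis a1_neq0 : a1 != 0.

Local Notation h := (hmap a0 a1).
Local Notation hP := (hmap a0%:P a1%:P).
Local Notation vecP := (yvec a0%:P a1%:P b%:P).
Local Notation f := (fmap a0 a1 b).

Lemma horner_map_eval (N : {poly {poly C}}) x y :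
  (map_poly (horner_eval y) N).[x] = N.[x, y].
Proof.
by rewrite -[x in LHS](hornerC x y) -[x%:P.[y]]/(horner_eval y x%:P) horner_map.
Qed.

Lemma no_transverse_fibration N D d : (forall k, ~ reaches_origin a0 a1 b k) ->
  D != 0 -> coprimep (swapXY N) (swapXY D) ->
  maxn (size (swapXY N)) (size (swapXY D)) = d.+2 ->
  ~ preserves_fibration f (polyF N / polyF D).
Proof.
move=> nr D0 cND m pres.
have [s [m1 [m2 [m3 [m4 [det Hs]]]]]] := fibration_moebius a1_neq0 D0 cND m pres.
pose K := maxn (size N) (size D).
(* With n = 2 (2 K) + 1 the first component has degree 2 K + 1, beyond the bound below; n stays
   abstract to keep iterates folded. *)
have [n nE] : {n | n = K.*2.*2.+1} by exists K.*2.*2.+1.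
have [y ny] := exists_section a1_neq0 nr n.
have nz := section_neq0 a1_neq0 ny.
have [t [l1 [l2 [l3 [l4 Ht]]]]] := orbit_chain a1_neq0 det Hs nz (leqnn n).
pose sec k (P : {poly {poly C}}) Q :=
  k.1 *: map_poly (horner_eval y) P + k.2 *: map_poly (horner_eval y) Q : {poly C}.
have secE k P Q x : (sec k P Q).[x] = k.1 * P.[x, y] + k.2 * Q.[x, y].
  by rewrite hornerD !hornerZ !horner_map_eval.
have size_sec k : (size (sec k N D) <= K)%N.
  rewrite (leq_trans (size_polyD _ _)) // geq_max.
  rewrite !(leq_trans (size_scale_leq _ _)) // (leq_trans (size_poly _ _)) //.
    by rewrite /K leq_maxr.
  by rewrite /K leq_maxl.
pose Bp := sec (l3, l4) N D; pose Ap := sec (l1, l2) N D.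
pose hn := iter n hP 'X; pose A := swapXY N; pose B := swapXY D.
(* As a polynomial in y over C[x], F has the image of the section under f^n as a root. *)
pose F := \poly_(j < maxn (size A) (size B))
  (Bp * (A`_j \Po hn) - Ap * (B`_j \Po hn)).
have coefF j : F`_j = Bp * (A`_j \Po hn) - Ap * (B`_j \Po hn).
  rewrite coef_poly; case: ltnP => //; rewrite geq_max => /andP[jA jB].
  by rewrite !nth_default // !comp_poly0 !mulr0 subrr.
have evalF x : map_poly (horner_eval x) F =
    Bp.[x] *: N.[(iter n h x)%:P] - Ap.[x] *: D.[(iter n h x)%:P].
  apply/polyP => j; rewrite coef_map coefF /= /horner_eval coefB !coefZ.
  rewrite !horner_polyC !coef_map /= /horner_eval.
  by rewrite hornerD hornerN !hornerM !horner_comp horner_iter_hmap.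
have [x0] := exists_notin (t ++ map (iter n (hinv a0 a1)) s).
rewrite mem_cat negb_or => /andP[x0t x0s].
have F0 : F != 0.
  have {}x0s : iter n h x0 \notin s.
    apply: contra x0s => x0s; apply/mapP; exists (iter n h x0) => //.
    by rewrite iter_hmapK.
  have [g _] := Hs _ x0s; have [_ _] := Ht x0 x0t.
  rewrite -(secE (l1, l2)) -(secE (l3, l4)) -/Ap -/Bp; apply: contraTneq => Fz.
  have := evalF x0; rewrite Fz rmorph0 -scaleNr => /esym/(pencil_free g)[-> /eqP].
  by rewrite oppr_eq0 => /eqP->; rewrite eqxx.
have sz : size (vecP n 'X (y%:P, 1)).1 = K.*2.+2.
  by rewrite nE; exact: size_yvec_odd.
have u0 : (vecP n 'X (y%:P, 1)).1 != 0 by rewrite -size_poly_eq0 sz.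
have v0 : (vecP n 'X (y%:P, 1)).2 != 0 by rewrite {1}nE; apply: nz; rewrite nE.
have cuv : coprimep (vecP n 'X (y%:P, 1)).1 (vecP n 'X (y%:P, 1)).2.
  apply: Pdiv.ClosedField.root_coprimep => x /rootP ux; apply/eqP => vx.
  by apply: (ny x); rewrite horner_section ux vx.
have [] := rational_root_dvdp F0 u0 v0 cuv (bad := t).
  move=> x xt; have [_ e _] := Ht x xt; rewrite evalF hornerD hornerN !hornerZ.
  rewrite !secE [X in X - _]mulrC [X in _ - X]mulrC; apply/eqP; rewrite subr_eq0.
  by move: e; rewrite horner_section /= => ->.
move=> j Fj /(dvdp_leq Fj); rewrite sz leqNgt => /negP; apply.
(* Composition with the linear polynomial h^n keeps degrees, so the coefficients of F have size at
   most 2 K. *)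
have size_term (P : {poly {poly C}}) k : (size P <= K)%N ->
    (size (sec k N D * ((swapXY P)`_j \Po hn))%R <= K.*2)%N.
  move=> sP; rewrite (leq_trans (size_polyMleq _ _)) //.
  rewrite size_comp_poly2; last by rewrite /hn size_iter_hmap.
  have := size_sec k; have := max_size_coefXY (swapXY P) j.
  rewrite sizeYE swapXYK => s1 s2; rewrite -addnn.
  by rewrite (leq_trans (leq_pred _)) // leq_add // (leq_trans s1).
rewrite coefF ltnS (leq_trans (size_polyD _ _)) // geq_max size_polyN.
by rewrite !(leq_trans (size_term _ _ _)) ?leq_maxl ?leq_maxr // leqnSn.
Qed.

Lemma preserved_fibration_x (V : ratfun C) :
  (forall k, ~ reaches_origin a0 a1 b k) -> preserves_fibration f V ->
  exists p q : {poly C}, [/\ q != 0, coprimep p q &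
    V = polyF (map_poly polyC p) / polyF (map_poly polyC q)].
Proof.
move=> nr pres; have [N [D [D0 VE cND]]] := ratfun_coprime V.
(* Size at least 2 means that y occurs, which is excluded; size 1 leaves functions of x; size 0
   contradicts D != 0. *)
case m : (maxn (size (swapXY N)) (size (swapXY D))) => [|[|d]]; last first.
- by case: (no_transverse_fibration nr D0 cND m); rewrite -VE.
- have [] : (size (swapXY N) <= 1)%N /\ (size (swapXY D) <= 1)%N.
    by rewrite -m leq_maxl leq_maxr.
  move/size1_polyC => NE /size1_polyC DE.
  move: NE DE; set p := (swapXY N)`_0; set q := (swapXY D)`_0 => NE DE.
  have NE' : N = map_poly polyC p by rewrite -swapXY_polyC -NE swapXYK.
  have DE' : D = map_poly polyC q by rewrite -swapXY_polyC -DE swapXYK.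
  have q0 : q != 0 by apply: contra_neq D0 => q0; rewrite DE' q0 rmorph0.
  pose g := gcdp p q; have g0 : g != 0 by rewrite gcdp_eq0 negb_and q0 orbT.
  have pE : p = p %/ g * g by rewrite divpK ?dvdp_gcdl.
  have qE : q = q %/ g * g by rewrite divpK ?dvdp_gcdr.
  exists (p %/ g), (q %/ g); split.
  + by apply: contra_neq q0 => e; rewrite qE e mul0r.
  + by apply: coprimep_div_gcd; rewrite q0 orbT.
  + rewrite VE NE' DE' {1}pE {1}qE !rmorphM /= -mulf_div divff ?mulr1 //.
    by rewrite polyF_eq0 map_polyC_eq0.
- have : swapXY D == 0 by rewrite -size_poly_leq0 -m leq_maxr.
  by rewrite swapXY_eq0 (negPf D0).
Qed.

End Uniqueness.

(** * Level curves of functions of x *)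

Section VerticalLines.

Variable C : numClosedFieldType.

(** If P(x, y) had positive degree in y, a generic vertical line would carry a zero of P, although
    g(x) != 0. So P depends on x alone, and irreducibility leaves a single root. *)
Lemma irreducible_curve_vertical (P : {poly {poly C}}) (g : {poly C}) :
  irreducible_curve P -> g != 0 ->
  (forall p : C * C, P.[p.1, p.2] = 0 -> g.[p.1] = 0) ->
  forall p p' : C * C, P.[p.1, p.2] = 0 -> P.[p'.1, p'.2] = 0 -> p.1 = p'.1.
Proof.
move=> [P0 _ irr] g0 Pg p p' Pp Pp'.
have [s gs] := poly_nonroots g.
pose Q := swapXY P.
have coefQ j : Q`_j.+1 = 0.
  apply: (@poly_cofinite_eq0 _ s) => x xs; apply/eqP; apply: contraT => Qx.
  have : size P.[x%:P] != 1%N.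
    apply/eqP => /eq_leq/leq_sizeP/(_ j.+1 isT).
    by rewrite horner_polyC coef_map /= /horner_eval => /eqP; rewrite (negPf Qx).
  move/closed_rootP => [y /rootP Py].
  have := Pg (x, y) Py; rewrite /= => /eqP gx.
  by move: (gs x xs g0); rewrite gx.
have [q PE] : exists q, P = map_poly polyC q.
  exists Q`_0; rewrite -swapXY_polyC -[LHS]swapXYK -/Q; congr swapXY.
  by apply/size1_polyC/leq_sizeP => -[|j] // _; exact: coefQ.
have PqE r : P.[r.1, r.2] = q.[r.1] by rewrite PE -swapXY_polyC horner2_swapXY hornerC.
have /rootP/factor_theorem[u uE] : q.[p.1] = 0 by rewrite -PqE.
have [] := irr (map_poly polyC u) (map_poly polyC ('X - p.1%:P)).
- by rewrite PE uE rmorphM.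
- move=> uU; have := Pp'; rewrite PqE uE hornerM => /eqP.
  rewrite mulf_eq0 => /orP[/eqP u0|]; last by rewrite !hornerE subr_eq0 => /eqP.
  have := rmorph_unit (horner_eval p'.2) (rmorph_unit (horner_eval p'.1%:P) uU).
  rewrite /= /horner_eval -swapXY_polyC horner2_swapXY hornerC u0.
  by rewrite unitr0.
- move=> vU.
  have := rmorph_unit (horner_eval 0) (rmorph_unit (horner_eval p.1%:P) vU).
  rewrite /= /horner_eval -swapXY_polyC horner2_swapXY hornerC !hornerE subrr.
  by rewrite unitr0.
Qed.

End VerticalLines.

Lemma same_level_curves_x (C : numClosedFieldType) (V : ratfun C) (p q : {poly C}) :
  q != 0 -> coprimep p q ->
  V = polyF (map_poly polyC p) / polyF (map_poly polyC q) -> nonconstant V ->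
  same_level_curves V (xF C).
Proof.
move=> q0 cpq VE ncV P.
have hE (u : {poly C}) (r : C * C) : (map_poly polyC u).[r.1, r.2] = u.[r.1].
  by rewrite -swapXY_polyC horner2_swapXY hornerC.
have tV r : takes V r (proj_div p.[r.1] q.[r.1]).
  rewrite VE -!(hE _ r); apply: takes_frac; rewrite ?map_polyC_eq0 // !hE.
  have [pr|//] := eqVneq p.[r.1] 0.
  by apply: coprimep_root cpq _; apply/rootP.
split=> -[irr [v Hv]]; split=> //.
  have [g g0 Pg] : exists2 g : {poly C}, g != 0 &
      forall r : C * C, P.[r.1, r.2] = 0 -> g.[r.1] = 0.
    case: v Hv => [c|] Hv; last first.
      exists q => // r Pr; have := Hv r Pr _ (tV r).
      by rewrite /proj_div; case: eqP.
    exists (p - c *: q) => [|r Pr].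
      apply/eqP => /subr0_eq pE; apply: (ncV c); rewrite VE pE -mul_polyC rmorphM.
      rewrite /= map_polyC polyFM mulfK //.
      by rewrite polyF_eq0 map_polyC_eq0.
    have := Hv r Pr _ (tV r); rewrite /proj_div; case: eqVneq => // qr [<-].
    by rewrite !hornerE divfK // subrr.
  have vert := irreducible_curve_vertical irr g0 Pg.
  (* On a curve without points any level will do. *)
  have [[r0 Pr0]|nP] := boolp.EM (exists r : C * C, P.[r.1, r.2] = 0).
    exists (Some r0.1) => r Pr v' tx.
    by rewrite -(takes_uniq (takes_x r) tx) (vert r r0).
  by exists None => r Pr; case: nP; exists r.
case: v Hv => [c|] Hv.
  exists (proj_div p.[c] q.[c]) => r Pr v' tv.
  rewrite -(takes_uniq (tV r) tv).
  by have [<-] := Hv r Pr _ (takes_x r).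
by exists None => r Pr; have := Hv r Pr _ (takes_x r).
Qed.

Theorem theorem13 (R : realType) (alpha0 alpha1 beta2 : R[i])
    (halpha1 : alpha1 != 0) :
  let f : ratmap R[i] := fmap alpha0 alpha1 beta2 in
  let x : ratfun R[i] := xF R[i] in
  let y : ratfun R[i] := yF R[i] in
  [/\ [/\ (forall p : nat, ~ reaches_origin alpha0 alpha1 beta2 p) ->
            [/\ preserves_fibration f x,
                subst x f = cst alpha0 + cst alpha1 * x &
                forall V : ratfun R[i],
                  preserves_fibration f V -> same_level_curves V x],
          forall n : nat, (1 < n)%N -> alpha1 ^+ n = 1 -> alpha1 != 1 ->
            integrable f /\ first_integral f (hprod alpha0 alpha1 n) &
          alpha1 = 1 -> alpha0 = 0 -> integrable f],
      forall p : nat, (1 <= p)%N -> reaches_origin alpha0 alpha1 beta2 p ->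
        periodic (2 * p + 2) f /\
        first_integral f (hprod alpha0 alpha1 (2 * p + 2)) &
      alpha0 = 0 -> beta2 = 0 ->
        f = (cst alpha1 * x, x / y) /\
        forall s : R[i], s ^+ 2 = alpha1 ->
          let V1 : ratfun R[i] := cst s * y + x / y in
          let V2 : ratfun R[i] := - cst s * y + x / y in
          [/\ preserves_fibration f V1 /\ preserves_fibration f V2,
              generically_transverse V1 V2,
              subst V1 f = cst s * V1,
              subst V2 f = - cst s * V2 &
              forall n : nat, (0 < n)%N -> alpha1 ^+ n = 1 ->
                [/\ periodic (2 * n) f,
                    first_integral f (V1 ^+ (2 * n)),
                    first_integral f (V2 ^+ (2 * n)) &
                    independent (V1 ^+ (2 * n)) (V2 ^+ (2 * n))]]].
Proof.
move=> f x y; split.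
- split.
  + move=> nr; split; first exact: preserves_fibration_x.
      exact: subst_fmap_x.
    move=> V pres; have [p [q [q0 cpq VE]]] := preserved_fibration_x halpha1 nr pres.
    exact: same_level_curves_x q0 cpq VE (proj1 pres).
  + move=> n n1 a1n a11; have n0 := ltnW n1.
    have fi := first_integral_hprod beta2 halpha1 n0
      (iter_hmap_root_of_unity alpha0 a1n a11) a1n.
    by split=> //; exists (hprod alpha0 alpha1 n).
  + move=> a11 a00; exists x; split; first exact: nonconstant_x.
    rewrite /f subst_fmap_x // a11 a00 (rmorph0 (@cst _)) (rmorph1 (@cst _)).
    by rewrite add0r mul1r.
- by move=> p p0; exact: periodic_reaches_origin.
move=> a00 b0; rewrite /f a00 b0; split; first exact: fmap00.
move=> s s2 /=; have ns2 : (- s) ^+ 2 = alpha1 by rewrite sqrrN.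
(* Both functions become members of the family [fib], with parameters s and - s. *)
rewrite -(rmorphN (@cst _)) -!/(fib _); split.
- by split; exact: preserves_fib.
- exact: transverse_fib halpha1 s2.
- exact: subst_fib.
- exact: subst_fib.
- move=> n n0 a1n; split.
  + exact: periodic_fmap00.
  + exact: first_integral_fib.
  + exact: first_integral_fib.
  + by apply: independent_fib halpha1 s2 _ _; rewrite muln_gt0.
Qed.
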